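(* For a nonnegative integer $m$, a strict partition $\lambda=(\lambda_1>\cdots>\lambda_k)$ with $k$ parts, and a set $I\subseteq[k]$, \[ \operatorname{M}_f(A(m;\lambda;I))^2=2^{k-|I|}\operatorname{M}(\widetilde{A}(m;\lambda;I)). \]
   Context: Triangular lattice: lattice points $P(a,b)=a e_1+b e_2$ ($a,b\in\mathbb Z$) with $e_1=(\sqrt3/2,1/2)$, $e_2=(0,1)$. For $a,b\in\mathbb Z$, $R(a,b)$ is the unit triangle with vertices $P(a,b),P(a,b+1),P(a+1,b)$ and $L(a,b)$ the unit triangle with vertices $P(a+1,b),P(a+1,b+1),P(a,b+1)$. A lozenge is the union of two unit triangles sharing an edge; a lozenge tiling of a region (a finite union of unit triangles) is a set of lozenges with disjoint interiors whose union is the region; the weight of a tiling is the product of its lozenges' weights, and $\operatorname{M}(R)$ is the sum of the weights of all tilings of $R$. Regions: $A(m;\lambda;I)$ is the union of (i) for each $c\in\{k,\ldots,m+k-1\}$, the triangles $R(a,c),L(a,c)$ with $-\lambda_1\le a\le -1$; (ii) for each $i\in[k]$, the triangles $R(a,k-i)$ with $-\lambda_i+1\le a\le -1$ and $L(a,k-i)$ with $-\lambda_i\le a\le -1$, except that $L(-\lambda_i,k-i)$ is omitted when $i\in I$. $\widetilde{A}(m;\lambda;I)$ is the union of $A(m;\lambda;I)$ with (iii) for each $c\in\{k,\ldots,m+k-1\}$, the triangles $R(a,c-a),L(a,c-a-1)$ with $0\le a\le\lambda_1$; (iv) for each $i\in[k]$, writing $c=k-i$, the triangles $R(a,c-a),L(a,c-a-1)$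 with $0\le a\le\lambda_i-1$, together with $R(\lambda_i,c-\lambda_i)$ unless $i\in I$. (This is the region obtained by concatenating along the vertical axis $\ell=\{x=0\}$, from top to bottom, $m$ $\wedge$-hooks of order $\lambda_1+1$ and shifted $\wedge$-hooks of orders $\lambda_1,\ldots,\lambda_k$, removing the forced leftmost strip, and removing the end triangles indexed by $I$; $A(m;\lambda;I)$ is its part left of $\ell$.) Weights: in $\widetilde{A}(m;\lambda;I)$, for each $i\in[k]\setminus I$ the lozenge $L(\lambda_i-1,k-i-\lambda_i)\cup R(\lambda_i,k-i-\lambda_i)$ has weight $1/2$ and all other lozenges weight $1$; all boundaries of $\widetilde{A}$ are solid. In $A(m;\lambda;I)$ all lozenges have weight $1$ and the part of its boundary on $\ell$ is free: a tiling of $A(m;\lambda;I)$ with free boundary is a set of lozenges with disjoint interiors covering $A(m;\lambda;I)$, each being either contained in $A(m;\lambda;I)$ or the union of a triangle $L(-1,c)$ of $A(m;\lambda;I)$ with the triangle $R(0,c)$ across $\ell$. $\operatorname{M}_f(A(m;\lambda;I))$ is the number of such tilings. *)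

(* Defs.v *)
From HB Require Import structures.
From mathcomp Require Import all_boot all_order all_algebra finmap.

Set Implicit Arguments.
Unset Strict Implicit.
Unset Printing Implicit Defensive.

Import Order.TTheory GRing.Theory Num.Theory.

Local Open Scope fset_scope.
Local Open Scope ring_scope.

Inductive triangle : Type := Rtri of int & int | Ltri of int & int.

Definition triangle_encode (t : triangle) : (int * int) + (int * int) :=
  match t with Rtri a b => inl (a, b) | Ltri a b => inr (a, b) end.
Definition triangle_decode (s : (int * int) + (int * int)) : triangle :=
  match s with inl p => Rtri p.1 p.2 | inr p => Ltri p.1 p.2 end.
Lemma triangle_encodeK : cancel triangle_encode triangle_decode.
Proof. by case. Qed.
HB.instance Definition _ := Choice.copy triangle (can_type triangle_encodeK).

(* As e_1, e_2 are linearly independent, the lattice point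
   P(a,b) = a e_1 + b e_2 is represented by its coordinate pair (a, b). *)
Definition vertices (t : triangle) : {fset int * int} :=
  match t with
  | Rtri a b => [fset (a, b); (a, b + 1); (a + 1, b)]
  | Ltri a b => [fset (a + 1, b); (a + 1, b + 1); (a, b + 1)]
  end.

Definition share_edge (t u : triangle) : bool :=
  #|` vertices t `&` vertices u| == 2%N.

(* A union of unit triangles is represented by the finite set of these
   triangles.  Distinct unit triangles have disjoint interiors, so two such
   unions have disjoint interiors iff the two sets are disjoint. *)
Definition is_lozenge (l : {fset triangle}) : bool :=
  [exists t : l, exists u : l,
     share_edge (val t) (val u) && (l == [fset val t; val u])].

Lemma is_lozengeP (l : {fset triangle}) :
  reflect (exists t u, share_edge t u /\ l = [fset t; u]) (is_lozenge l).
Proof.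
apply: (iffP existsP) => [[t /existsP[u /andP[tu /eqP ->]]]|[t [u [tu ->]]]].
  by exists (val t), (val u).
have ti : t \in [fset t; u] by rewrite !inE eqxx.
have ui : u \in [fset t; u] by rewrite !inE eqxx orbT.
by exists [` ti]; apply/existsP; exists [` ui]; rewrite /= tu /=.
Qed.

Definition lozenges_in (S : {fset triangle}) : {fset {fset triangle}} :=
  [fset l in fpowerset S | is_lozenge l].

Lemma in_lozenges_in (S l : {fset triangle}) :
  (l \in lozenges_in S) = is_lozenge l && (l `<=` S).
Proof. by rewrite !inE /= fpowersetE andbC. Qed.

Definition is_tiling (S : {fset triangle}) (T : {fset {fset triangle}}) : bool :=
  [&& T `<=` lozenges_in S, trivIfset T & fcover T == S].

Definition tilings (S : {fset triangle}) : {fset {fset {fset triangle}}} :=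
  [fset T in fpowerset (lozenges_in S) | is_tiling S T].

Lemma in_tilings S T : (T \in tilings S) = is_tiling S T.
Proof. by rewrite !inE /= fpowersetE /is_tiling; case: (T `<=` _). Qed.

Definition M (w : {fset triangle} -> rat) (S : {fset triangle}) : rat :=
  \sum_(T <- tilings S) \prod_(l <- T) w l.

(* The lozenges L(-1,c) + R(0,c) protruding across the free boundary
   {x = 0}, for L(-1,c) in S. *)
Definition on_axis (t : triangle) : bool :=
  if t is Ltri a _ then a == -1 else false.
Definition across (t : triangle) : triangle :=
  match t with Rtri _ c | Ltri _ c => Rtri 0 c end.
Definition crossing_lozenges (S : {fset triangle}) : {fset {fset triangle}} :=
  [fset [fset t; across t] | t in S & on_axis t].

Lemma crossing_lozengesP (S l : {fset triangle}) :
  reflect (exists2 c, Ltri (-1) c \in S & l = [fset Ltri (-1) c; Rtri 0 c])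
          (l \in crossing_lozenges S).
Proof.
apply: (iffP (imfsetP _ _ _ _)) => [[t]|[c cS ->]].
  rewrite inE /= => /andP[tS]; case: t tS => a b //= tS /eqP a1 ->.
  by rewrite a1 in tS *; exists b.
by exists (Ltri (-1) c); rewrite // inE /= cS.
Qed.

Definition is_free_tiling (S : {fset triangle}) (T : {fset {fset triangle}}) :
    bool :=
  [&& T `<=` lozenges_in S `|` crossing_lozenges S,
      trivIfset T & S `<=` fcover T].

Definition free_tilings (S : {fset triangle}) : {fset {fset {fset triangle}}} :=
  [fset T in fpowerset (lozenges_in S `|` crossing_lozenges S)
     | is_free_tiling S T].

Lemma in_free_tilings S T : (T \in free_tilings S) = is_free_tiling S T.
Proof. by rewrite !inE /= fpowersetE /is_free_tiling; case: (T `<=` _). Qed.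

Definition Mf (S : {fset triangle}) : nat := #|` free_tilings S|.

(* The integers x, x + 1, ..., y (none if y < x). *)
Definition zrange (x y : int) : seq int :=
  if x <= y then [seq x + i%:Z | i <- iota 0 `|y - x|.+1] else [::].

Lemma mem_zrange (x y a : int) : (a \in zrange x y) = (x <= a <= y).
Proof.
rewrite /zrange; case: ifP => [xy|/negbT]; last first.
  rewrite -ltNge => yx; rewrite in_nil; apply/esym/negP => /andP[xa ay].
  by have := lt_le_trans yx (le_trans xa ay); rewrite ltxx.
have yx0 : 0 <= y - x by rewrite subr_ge0.
apply/mapP/andP => [[i]|[xa ay]].
  rewrite mem_iota add0n /= ltnS => iyx ->; split; first by rewrite lerDl.
  by rewrite -lerBrDl -(gez0_abs yx0) lez_nat.
have ax0 : 0 <= a - x by rewrite subr_ge0.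
exists `|a - x|%N; last by rewrite gez0_abs // addrCA subrr addr0.
by rewrite mem_iota add0n /= ltnS -lez_nat !gez0_abs // lerD2r.
Qed.

Section Regions.
Variables (m k : nat) (lam : k.-tuple nat) (I : {set 'I_k}).

Definition strict_partition : bool := sorted gtn lam && all (leq 1) lam.

(* lambda_1, read as 0 for the empty partition *)
Definition lam1 : int := (head 0%N lam)%:Z.

(* 'I_k counts from 0, so i : 'I_k stands for the index i + 1 of [k]: [part i]
   is lambda_{i+1}, [level i] is k - (i + 1). *)
Definition part (i : 'I_k) : int := (tnth lam i)%:Z.
Definition level (i : 'I_k) : int := k%:Z - i.+1%:Z.

Definition hook_levels : seq int := zrange k%:Z (m%:Z + k%:Z - 1).

Definition regionA : {fset triangle} :=
  [fset Rtri a c | c in hook_levels, a in zrange (- lam1) (-1)]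
  `|` [fset Ltri a c | c in hook_levels, a in zrange (- lam1) (-1)]
  `|` \bigcup_(i <- enum 'I_k)
        ([fset Rtri a (level i) | a in zrange (- part i + 1) (-1)]
         `|` [fset Ltri a (level i) | a in zrange (- part i) (-1)
                & ~~ ((i \in I) && (a == - part i))]).

Definition regionAtilde : {fset triangle} :=
  regionA
  `|` [fset Rtri a (c - a) | c in hook_levels, a in zrange 0 lam1]
  `|` [fset Ltri a (c - a - 1) | c in hook_levels, a in zrange 0 lam1]
  `|` \bigcup_(i <- enum 'I_k)
        ([fset Rtri a (level i - a) | a in zrange 0 (part i - 1)]
         `|` [fset Ltri a (level i - a - 1) | a in zrange 0 (part i - 1)]
         `|` (if i \in I then fset0
              else [fset Rtri (part i) (level i - part i)])).

Definition weightAtilde (l : {fset triangle}) : rat :=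
  if [exists i : 'I_k, (i \notin I) &&
        (l == [fset Ltri (part i - 1) (level i - part i);
                    Rtri (part i) (level i - part i)])]
  then 1 / 2 else 1.

End Regions.

(* Main.v *)
Require Import Defs.
From mathcomp Require Import all_boot all_order all_algebra finmap.
From mathcomp Require Import ring zify.

Set Implicit Arguments.
Unset Strict Implicit.
Unset Printing Implicit Defensive.

Import Order.TTheory GRing.Theory Num.Theory.
Local Open Scope fset_scope.
Local Open Scope ring_scope.

(** Let [H = m + k].  Cut the tilings of both regions along the axis, and let [X]
be the set of the levels at which a lozenge crosses it.  Growing either half
column by column and bottom to top, one pair of triangles at a time, shows that
its number of (weighted) tilings is the coefficient of the top monomial in the
exterior product of vectors [p_c], [c] in [X], which are updated by
[p_c := p_c + p_(c-1)].  For the left half [p_c] has coordinates the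
coefficients of [(1 - z)^(-lambda_i)]; for the right half, which has one more
column and the weights 1/2, one finds [2^(k - |I|)] times the same quantity for
[u_c = p_c + 2 (p_0 + ... + p_(c-1))].  Hence the theorem says that
[(sum_X det p_X)^2 = sum_X (det p_X) (det u_X)].

In the exterior algebra of two copies of the space, with [p'_c] the second copy
of [p_c], the left side is the top coefficient of
[(1 + p_(H-1)) ... (1 + p_0) (1 + p'_0) ... (1 + p'_(H-1))].  In the basis in
which [q_c = p_c + p'_c] is the second copy, this product equals
[prod_c (1 + q_c) * prod_c (1 + p_c (q_c + 2 (q_0 + ... + q_(c-1))))], and by
degree reasons the first factor does not contribute to the top coefficient.
The exterior algebra acts by the creation operators of a fermionic Fock
space. *)

(** * Fermionic Fock space *)

(** The left side is the square of a sum, hence has terms with two different sets [X] and [Y], while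
    the right side is diagonal; the factorisation turns one expansion into the other. Its first
    factor is invisible because the first copy is given degree -1 and the second degree 1: the top
    monomial and every [p_c (q_c + 2 (q_0 + ...))] have degree 0, every [q_c] has degree 1. The
    change of basis is unimodular, so one covector reads off both products. The factor 2 has two
    origins that must agree. In the algebra, an odd [x] moves through [1 + q] with [q q = 0] by
    [x (1 + q) = (1 + q) (x + 2 x q)]. In the tilings, a row outside [I] with part [y] contributes
    [(1 - z)^(-y)] on the left and, once doubled, [(1 + z) (1 - z)^(-y-1)] on the right, the weight
    1/2 producing the numerator; the quotient is [(1 + z) / (1 - z) = 1 + 2 z + 2 z^2 + ...]. No
    determinant is formed: a minor is characterised by how it scales the pairing of two vectors, for
    every system of creators. *)

Section Fock.

Fixpoint fdim (d : nat) : nat := if d is d'.+1 then (fdim d' + fdim d')%N else 1%N.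

(* Jordan-Wigner representation of the creation operators. *)
Fixpoint cr (d i : nat) : 'M[rat]_(fdim d) :=
  if d is d'.+1 then
    if i is i'.+1 then block_mx (cr d' i') 0 0 (- cr d' i')
    else block_mx 0 0 1%:M 0
  else 0.

Fixpoint an (d i : nat) : 'M[rat]_(fdim d) :=
  if d is d'.+1 then
    if i is i'.+1 then block_mx (an d' i') 0 0 (- an d' i')
    else block_mx 0 1%:M 0 0
  else 0.

Fixpoint vac (d : nat) : 'cV[rat]_(fdim d) :=
  if d is d'.+1 then col_mx (vac d') 0 else 1%:M.

(** This covector reads off the coefficient of the monomial whose modes are those of [S], written in
    increasing order; it replaces the top form of the exterior algebra. *)
Fixpoint bra (d : nat) (S : pred nat) : 'rV[rat]_(fdim d) :=
  if d is d'.+1 then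
    if S 0%N then row_mx 0 (bra d' (fun i => S i.+1))
    else row_mx (bra d' (fun i => S i.+1)) 0
  else 1%:M.

Definition acomm n (x y : 'M[rat]_n) := x *m y + y *m x.

Lemma cr_cr d i j : acomm (cr d i) (cr d j) = 0.
Proof.
rewrite /acomm; elim: d i j => [|d IH] [|i] [|j] /=; rewrite ?mulmx0 ?addr0 //;
  rewrite !mulmx_block !(mulmx0, mul0mx, mulmx1, mul1mx, addr0, add0r)
    ?(mulmxN, mulNmx) ?opprK add_block_mx ?addr0 ?subrr ?addNr ?IH ?block_mx0 //.
Qed.

(** The bound is needed because [cr d j] is 0 for [j >= d]. *)
Lemma an_cr d i j : (j < d)%N -> acomm (an d i) (cr d j) = (i == j)%:R%:M.
Proof.
rewrite /acomm; elim: d i j => [|d IH] [|i] [|j] //= ltjd;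
  rewrite !mulmx_block !(mulmx0, mul0mx, mulmx1, mul1mx, addr0, add0r)
    ?(mulmxN, mulNmx) ?opprK add_block_mx ?addr0 ?add0r ?subrr ?addNr ?IH
    -?scalar_mx_block ?block_mx0 ?raddf0 //.
Qed.

Lemma an_vac d i : an d i *m vac d = 0.
Proof.
elim: d i => [|d IH] [|i] /=; rewrite ?mul0mx //
  mul_block_col !(mulmx0, mul0mx, addr0) ?IH col_mx0 //.
Qed.

Lemma bra_an d (S : pred nat) i : S i -> bra d S *m an d i = 0.
Proof.
elim: d S i => [|d IH] S [|i] /= Si; rewrite ?mulmx0 // ?Si.
  by rewrite mul_row_block !(mulmx0, mul0mx, addr0) row_mx0.
by case: ifP => _; rewrite mul_row_block !(mulmx0, mul0mx, addr0, add0r)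
  ?mulmxN (IH (fun i => S i.+1)) ?oppr0 ?row_mx0.
Qed.

Lemma bra_cr d (S : pred nat) i : ~~ S i -> bra d S *m cr d i = 0.
Proof.
elim: d S i => [|d IH] S [|i] /= Si; rewrite ?mulmx0 // ?(negbTE Si).
  by rewrite mul_row_block !(mulmx0, mul0mx, addr0) row_mx0.
by case: ifP => _; rewrite mul_row_block !(mulmx0, mul0mx, addr0, add0r)
  ?mulmxN (IH (fun i => S i.+1)) ?oppr0 ?row_mx0.
Qed.

Lemma eq_bra d (S S' : pred nat) :
  (forall i, (i < d)%N -> S i = S' i) -> bra d S = bra d S'.
Proof.
elim: d S S' => [|d IH] S S' SS' //=.
by rewrite SS' // (IH (fun i => S i.+1) (fun i => S' i.+1)) // => i id; apply: SS'.
Qed.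

(** The Jordan-Wigner sign of mode [j] counts the occupied modes below [j], and there are none. *)
Lemma bra_cr_min d (S : pred nat) j : (j < d)%N -> (forall i, (i < j)%N -> ~~ S i) -> S j ->
  bra d S *m cr d j = bra d (fun i => S i && (i != j)).
Proof.
elim: d S j => [|d IH] S [|j] //= jd lS Sj.
  rewrite Sj /= mul_row_block !(mulmx0, mul0mx, mulmx1, addr0, add0r).
  by congr row_mx; apply: eq_bra => i _; rewrite andbT.
rewrite (negbTE (lS 0%N _)) //= mul_row_block !(mulmx0, mul0mx, addr0, add0r).
by rewrite (IH (fun i => S i.+1)) // => i ij; apply: lS.
Qed.

Lemma bra_vac d : bra d pred0 *m vac d = 1%:M.
Proof.
elim: d => [|d IH] /=; first by rewrite mulmx1.
by rewrite mul_row_col mul0mx addr0 (eq_bra (S' := pred0)).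
Qed.

End Fock.

(** * Ordered products *)

Section OrderedProducts.
Variable N : nat.
Implicit Types (F G : nat -> 'M[rat]_N) (x y : 'M[rat]_N).

Fixpoint dprod n F := if n is n'.+1 then F n' *m dprod n' F else 1%:M.
Fixpoint iprod n F := if n is n'.+1 then iprod n' F *m F n' else 1%:M.

Lemma eq_dprod n F G : (forall c, (c < n)%N -> F c = G c) -> dprod n F = dprod n G.
Proof.
elim: n => //= n IH FG; rewrite FG // IH // => c cn.
by apply: FG; rewrite ltnS ltnW.
Qed.

Lemma eq_iprod n F G : (forall c, (c < n)%N -> F c = G c) -> iprod n F = iprod n G.
Proof.
elim: n => //= n IH FG; rewrite FG // IH // => c cn.
by apply: FG; rewrite ltnS ltnW.
Qed.

Lemma tr_dprod n F : (dprod n F)^T = iprod n (fun c => (F c)^T).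
Proof. by elim: n => /= [|n IH]; rewrite ?trmx1 // trmx_mul IH. Qed.

(** [A] and [B] are chosen before [G], so that products differing in one factor only can be compared
    and expanded linearly in that factor. *)
Lemma dprod_site n c F : (c < n)%N -> exists A B, forall G,
  (forall c', (c' < n)%N -> c' != c -> G c' = F c') -> dprod n G = A *m G c *m B.
Proof.
elim: n => // n IH; rewrite ltnS leq_eqVlt => /orP[/eqP ->|cn] /=.
  exists 1%:M, (dprod n F) => G GF; rewrite mul1mx; congr (_ *m _).
  by apply: eq_dprod => c' c'n; apply: GF; [exact: ltnW | rewrite ltn_eqF].
have [A [B AB]] := IH cn; exists (F n *m A), B => G GF.
rewrite GF ?ltnSn 1?eq_sym ?ltn_eqF // (AB G) ?mulmxA // => c' c'n.
by apply: GF; apply: ltnW.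
Qed.

(** Two neighbouring factors are isolated at once because a growth step can move a vector from
    height [c.+1] to height [c]. *)
Lemma dprod_site2 n c F : (c.+1 < n)%N -> exists A B, forall G,
  (forall c', (c' < n)%N -> c' != c -> c' != c.+1 -> G c' = F c') ->
  dprod n G = A *m (G c.+1 *m G c) *m B.
Proof.
elim: n => // n IH; rewrite ltnS leq_eqVlt => /orP[/eqP <-|cn] /=.
  exists 1%:M, (dprod c F) => G GF; rewrite mul1mx -mulmxA; congr (_ *m (_ *m _)).
  by apply: eq_dprod => c' c'n; apply: GF; rewrite ?ltn_eqF //; lia.
have [A [B AB]] := IH cn; exists (F n *m A), B => G GF.
rewrite GF; [|lia..]; rewrite (AB G) ?mulmxA // => c' c'n.
by apply: GF; apply: ltnW.
Qed.

Lemma acommE x y : acomm x y = 0 -> x *m y = - (y *m x).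
Proof. by move/eqP; rewrite addr_eq0 => /eqP. Qed.

Lemma acomm_sym x y : acomm x y = acomm y x.
Proof. exact: addrC. Qed.

Lemma acommDr x y z : acomm x (y + z) = acomm x y + acomm x z.
Proof. by rewrite /acomm mulmxDr mulmxDl addrACA. Qed.

Lemma acommNr x y : acomm x (- y) = - acomm x y.
Proof. by rewrite /acomm mulmxN mulNmx opprD. Qed.

Lemma acommBr x y z : acomm x (y - z) = acomm x y - acomm x z.
Proof. by rewrite acommDr acommNr. Qed.

Lemma acommDl x y z : acomm (y + z) x = acomm y x + acomm z x.
Proof. by rewrite !(acomm_sym _ x) acommDr. Qed.

Lemma acommBl x y z : acomm (y - z) x = acomm y x - acomm z x.
Proof. by rewrite !(acomm_sym _ x) acommBr. Qed.

Lemma acommZr x y k : acomm x (k *: y) = k *: acomm x y.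
Proof. by rewrite /acomm -scalemxAr -scalemxAl scalerDr. Qed.

Lemma acomm_sumr x n (f : 'I_n -> 'M[rat]_N) :
  acomm x (\sum_i f i) = \sum_i acomm x (f i).
Proof. by rewrite /acomm mulmx_sumr mulmx_suml -big_split. Qed.

Lemma acomm_sqr x : acomm x x = 0 -> x *m x = 0.
Proof. 
move=> h; apply: (scalerI (a := 2%:R)) => //.
by rewrite scaler0 scaler_nat mulr2n.
Qed.

(** The sign is left unspecified: an annihilator is only ever moved towards a vector that it
    kills. *)
Definition gcomm b x := exists s : bool, b *m x = (-1) ^+ s *: (x *m b).

Lemma gcomm1 b : gcomm b 1%:M.
Proof. by exists false; rewrite mulmx1 mul1mx scale1r. Qed.

Lemma gcomm_acomm b x : acomm b x = 0 -> gcomm b x.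
Proof. by move/acommE => bx; exists true; rewrite bx expr1 scaleN1r. Qed.

Lemma gcomm_swap b x : gcomm b x -> exists s : bool, x *m b = (-1) ^+ s *: (b *m x).
Proof. by move=> [s bx]; exists s; rewrite bx scalerA -signr_addb addbb scale1r. Qed.

Lemma gcommM b x y : gcomm b x -> gcomm b y -> gcomm b (x *m y).
Proof.
move=> [s bx] [t yt]; exists (s (+) t).
by rewrite mulmxA bx -scalemxAl -mulmxA yt -scalemxAr scalerA signr_addb mulmxA.
Qed.

Lemma gcomm_dprod b n F : (forall c, (c < n)%N -> gcomm b (F c)) -> gcomm b (dprod n F).
Proof.
elim: n => /= [|n IH] bF; first exact: gcomm1.
by apply: gcommM; [exact: bF | apply: IH => c cn; apply: bF; apply: ltnW].
Qed.

Lemma gcomm_iprod b n F : (forall c, (c < n)%N -> gcomm b (F c)) -> gcomm b (iprod n F).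
Proof.
elim: n => /= [|n IH] bF; first exact: gcomm1.
by apply: gcommM; [apply: IH => c cn; apply: bF; apply: ltnW | exact: bF].
Qed.

Lemma comm_pair x y z : acomm x z = 0 -> acomm y z = 0 -> x *m y *m z = z *m (x *m y).
Proof.
by move=> xz yz; rewrite -mulmxA (acommE yz) mulmxN (mulmxA x) (acommE xz) mulNmx opprK mulmxA.
Qed.

Lemma comm1D x y : x *m y = y *m x ->
  (1%:M + x) *m (1%:M + y) = (1%:M + y) *m (1%:M + x).
Proof. by move=> xy; rewrite !(mulmxDl, mulmxDr, mul1mx, mulmx1) xy addrACA. Qed.

Lemma comm_dprod z n F : (forall c, (c < n)%N -> F c *m z = z *m F c) ->
  dprod n F *m z = z *m dprod n F.
Proof.
elim: n => /= [|n IH] zF; first by rewrite mul1mx mulmx1.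
rewrite -mulmxA IH => [|c cn]; last by apply: zF; apply: ltnW.
by rewrite !mulmxA zF.
Qed.

(** The factors are nested, with [F 0] and [G 0] adjacent in the middle; the pairs already formed
    there are moved past the next [G c]. *)
Lemma dprod_iprod n F G :
  (forall c d, (d < c < n)%N -> F d *m G d *m G c = G c *m (F d *m G d)) ->
  dprod n F *m iprod n G = dprod n (fun c => F c *m G c).
Proof.
elim: n => /= [|n IH] FG; first by rewrite mulmx1.
rewrite mulmxA -(mulmxA (F n)) IH => [|c d /andP[dc cn]]; last first.
  by apply: FG; rewrite dc ltnW.
by rewrite -!mulmxA comm_dprod // => c cn; rewrite FG ?cn /=.
Qed.

End OrderedProducts.

(** * Factorisation of the product over the two copies *)

Section PairIdentity.
Variables (N : nat) (p q : nat -> 'M[rat]_N).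
Hypothesis pp : forall c d, acomm (p c) (p d) = 0.
Hypothesis pq : forall c d, acomm (p c) (q d) = 0.
Hypothesis qq : forall c d, acomm (q c) (q d) = 0.

Definition partial_sum n : 'M[rat]_N := \sum_(d < n) q d.
Definition cumul c : 'M[rat]_N := q c + 2 *: partial_sum c.

Lemma acomm_partial_sum x n : (forall d, acomm x (q d) = 0) ->
  acomm x (partial_sum n) = 0.
Proof. by move=> xq; rewrite acomm_sumr big1. Qed.

Lemma acomm_cumul x c : (forall d, acomm x (q d) = 0) -> acomm x (cumul c) = 0.
Proof. by move=> xq; rewrite acommDr acommZr xq acomm_partial_sum // scaler0 addr0. Qed.

(** Since [q q = 0], one has [1 - q = (1 + q) (1 - 2 q)], so [x (1 + q) = (1 - q) x = (1 + q) (x + 2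
    x q)]. The terms [x q] collected before are even and commute with the next [1 + q], so no
    products of several [q] arise. *)
Lemma conj_iprod n x : (forall d, acomm x (q d) = 0) ->
  (1%:M + x) *m iprod n (fun c => 1%:M + q c) =
  iprod n (fun c => 1%:M + q c) *m (1%:M + x + 2 *: (x *m partial_sum n)).
Proof.
move=> xq; elim: n => /= [|n IH].
  by rewrite /partial_sum big_ord0 mulmx0 scaler0 addr0 mulmx1 mul1mx.
rewrite mulmxA IH -!mulmxA; congr (_ *m _).
rewrite /partial_sum big_ord_recr /= -/(partial_sum n).
have sq : partial_sum n *m q n = - (q n *m partial_sum n).
  by apply: acommE; rewrite acomm_sym acomm_partial_sum.
have xqn := acommE (xq n); have qnx : q n *m x = - (x *m q n) by rewrite xqn opprK.
have qxq : q n *m (x *m q n) = 0 by rewrite mulmxA qnx mulNmx -mulmxA (acomm_sqr (qq n n)) mulmx0 oppr0.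
rewrite !(mulmxDl, mulmxDr, mul1mx, mulmx1) -?scalemxAl -?scalemxAr.
rewrite !mulmxDr !scalerDr -(mulmxA x) sq mulmxN (mulmxA (q n) x) qnx mulNmx -mulmxA qxq scaler0 addr0.
move: (x *m q n) (x *m (q n *m partial_sum n)) (x *m partial_sum n) => X Y Z.
by apply/matrixP => i j; rewrite !mxE; ring.
Qed.

(** Induction wraps the product in [1 + p n] and [1 + (q n - p n)]. The latter commutes with the
    even factors on the right, the former crosses the [1 + q c] by [conj_iprod], and where they meet
    they give [(1 + q n) (1 + p n *m cumul n)]. *)
Lemma pair_identity n :
  dprod n (fun c => 1%:M + p c) *m iprod n (fun c => 1%:M + (q c - p c)) =
  iprod n (fun c => 1%:M + q c) *m dprod n (fun c => 1%:M + p c *m cumul c).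
Proof.
elim: n => [|n IH] /=; first by [].
rewrite mulmxA -(mulmxA (_ + p n)) IH -!mulmxA.
rewrite comm_dprod => [|c cn]; last first.
  apply: comm1D; apply: comm_pair; first by rewrite acommBr pq pp subrr.
  by rewrite acomm_sym; apply: acomm_cumul => d; rewrite acommBl qq pq subrr.
rewrite mulmxA conj_iprod; last exact: pq.
rewrite -!mulmxA; congr (_ *m _); rewrite !mulmxA; congr (_ *m _).
rewrite /cumul; set s := partial_sum n.
have ps : p n *m s = - (s *m p n) by apply/acommE/acomm_partial_sum => d; exact: pq.
have qs : q n *m s = - (s *m q n) by apply/acommE/acomm_partial_sum => d; exact: qq.
have qp : q n *m p n = - (p n *m q n) by apply/acommE; rewrite acomm_sym pq.
have p2 := acomm_sqr (pp n n); have q2 := acomm_sqr (qq n n).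
have sp : s *m p n = - (p n *m s) by rewrite ps opprK.
rewrite !(mulmxDl, mulmxDr, mul1mx, mulmx1, mulmxN) -?scalemxAl -?scalemxAr ?mulmxDr.
have psp : p n *m s *m p n = 0 by rewrite -mulmxA sp mulmxN mulmxA p2 mul0mx oppr0.
have qpq : q n *m (p n *m q n) = 0 by rewrite mulmxA qp mulNmx -mulmxA q2 mulmx0 oppr0.
have qps : q n *m (p n *m s) = p n *m s *m q n.
  by rewrite mulmxA qp mulNmx -(mulmxA (p n) (q n)) qs mulmxN opprK mulmxA.
rewrite p2 psp qpq qps; move: (p n *m s) (p n *m s *m q n) (p n *m q n) => X Y Z.
by apply/matrixP => i j; rewrite !mxE; ring.
Qed.

End PairIdentity.

Definition sel N (X : pred nat) (F : nat -> 'M[rat]_N) c := if X c then F c else 1%:M.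

Definition pairing N (a : 'rV[rat]_N) (x : 'M_N) (b : 'cV_N) : rat := (a *m x *m b) 0 0.

Lemma pairingD N a x y b : @pairing N a (x + y) b = pairing a x b + pairing a y b.
Proof. by rewrite /pairing mulmxDr mulmxDl mxE. Qed.

Lemma pairingZ N a k x b : @pairing N a (k *: x) b = k * pairing a x b.
Proof. by rewrite /pairing -scalemxAr -scalemxAl mxE. Qed.

Lemma pairing0 N a b : @pairing N a 0 b = 0.
Proof. by rewrite /pairing mulmx0 mul0mx mxE. Qed.

Lemma pairing_sum N a b (T : Type) (r : seq T) (F : T -> 'M_N) :
  pairing a (\sum_(i <- r) F i) b = \sum_(i <- r) pairing a (F i) b.
Proof. by rewrite /pairing mulmx_sumr mulmx_suml summxE. Qed.

Lemma pairing_mulr N a x y b : @pairing N a (x *m y) b = pairing a x (y *m b).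
Proof. by rewrite /pairing !mulmxA. Qed.

Lemma pairing_tr N a x y b :
  @pairing N a (x *m y) b = pairing b^T y^T (a *m x)^T.
Proof. by rewrite /pairing -!trmx_mul !mulmxA [in RHS]mxE. Qed.

Fixpoint subseqs n : seq (seq nat) :=
  if n is n'.+1 then subseqs n' ++ [seq n' :: X | X <- subseqs n'] else [:: [::]].

Lemma subseqs_lt n X c : X \in subseqs n -> c \in X -> (c < n)%N.
Proof.
elim: n X => [|n IH] X /=; first by rewrite inE => /eqP ->.
rewrite mem_cat => /orP[XS cX|/mapP[Y YS ->]]; first exact: ltnW (IH _ XS cX).
by rewrite inE => /orP[/eqP -> //|/(IH _ YS)/ltnW].
Qed.

Lemma dprod_subseqs N n (p : nat -> 'M[rat]_N) :
  dprod n (fun c => 1%:M + p c) = \sum_(X <- subseqs n) dprod n (sel (mem X) p).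
Proof.
elim: n => /= [|n IH]; first by rewrite big_seq1.
rewrite big_cat big_map mulmxDl mul1mx IH mulmx_sumr.
congr (_ + _); rewrite !big_seq; apply: eq_bigr => X XS.
  rewrite {2}/sel /= ifF ?mul1mx //; apply/negP => /(subseqs_lt XS).
  by rewrite ltnn.
rewrite {2}/sel /= mem_head; congr (_ *m _); apply: eq_dprod => c cn.
by rewrite /sel /= inE ltn_eqF.
Qed.

Lemma iprod_subseqs N n (p : nat -> 'M[rat]_N) :
  iprod n (fun c => 1%:M + p c) = \sum_(X <- subseqs n) iprod n (sel (mem X) p).
Proof.
apply: trmx_inj; rewrite linear_sum /=.
have trE m (F : nat -> 'M[rat]_N) : (iprod m F)^T = dprod m (fun c => (F c)^T).
  by apply: trmx_inj; rewrite tr_dprod trmxK; apply: eq_iprod => c _; rewrite trmxK.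
under eq_bigr do rewrite trE.
rewrite trE (@eq_dprod _ _ _ (fun c => 1%:M + (p c)^T)) => [|c _]; last first.
  by rewrite linearD /= trmx1.
rewrite dprod_subseqs; apply: eq_bigr => X _; apply: eq_dprod => c _.
by rewrite /sel; case: ifP => _ //; rewrite trmx1.
Qed.

(** * Minors as matrix elements in Fock space *)

Section Representation.
Variables (H : nat) (S0 : pred nat).

Definition vec N (g : nat -> 'M[rat]_N) (cf : nat -> nat -> rat) c : 'M[rat]_N :=
  \sum_(d < H | S0 d) cf d c *: g d.

(* This makes [pairing a _ b] vanish on the products of vectors that do not
   involve some [g c] with [c] in [S0]. *)
Definition creators N (g : nat -> 'M[rat]_N) (a : 'rV_N) (b : 'cV_N) :=
  (forall c d, acomm (g c) (g d) = 0) /\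
  (forall c, (c < H)%N -> S0 c -> exists B, [/\ acomm B (g c) = 1%:M, a *m B = 0,
     B *m b = 0 & forall d, (d < H)%N -> d != c -> acomm B (g d) = 0]).

(* In other words, [Z X] is the minor of [cf] on the rows in [S0] and the columns
   in [X]. *)
Definition represents (Z : seq nat -> rat) (cf : nat -> nat -> rat) :=
  forall N (g : nat -> 'M[rat]_N) a b, creators g a b ->
  forall X, X \in subseqs H ->
  Z X * pairing a (dprod H (sel S0 g)) b = pairing a (dprod H (sel (mem X) (vec g cf))) b.

Lemma acomm_vec N x (g : nat -> 'M[rat]_N) cf c :
  (forall d, (d < H)%N -> S0 d -> acomm x (g d) = 0) -> acomm x (vec g cf c) = 0.
Proof.
move=> xg; rewrite /vec big_mkcond acomm_sumr big1 // => d _.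
by case: ifP => Sd; rewrite ?acommZr ?xg ?scaler0 // /acomm mulmx0 mul0mx addr0.
Qed.

Lemma acomm_vec2 N (g g' : nat -> 'M[rat]_N) cf cf' c c' :
  (forall d d', acomm (g d) (g' d') = 0) -> acomm (vec g cf c) (vec g' cf' c') = 0.
Proof.
move=> gg; apply: acomm_vec => d' _ _; rewrite acomm_sym.
by apply: acomm_vec => d _ _; rewrite acomm_sym.
Qed.

Lemma comm_vec N (D : 'M[rat]_N) (g : nat -> 'M[rat]_N) cf c l :
  (forall d, (d < H)%N -> D *m g d - g d *m D = l *: g d) ->
  D *m vec g cf c - vec g cf c *m D = l *: vec g cf c.
Proof.
move=> dg; rewrite mulmx_suml mulmx_sumr -sumrB scaler_sumr.
apply: eq_bigr => d _; rewrite -scalemxAl -scalemxAr -scalerBr dg //.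
by rewrite !scalerA mulrC.
Qed.

(** Insert [1 = B G + G B]: in the first term [B] is killed by [a], in the second it passes [x] up
    to sign and is killed by [b]. *)
Lemma pairing_absent N a b B G x : a *m B = 0 -> B *m b = 0 -> acomm B G = 1%:M ->
  gcomm B x -> @pairing N a x b = 0.
Proof.
move=> aB Bb BG [s Bx]; rewrite -[x]mul1mx -BG mulmxDl pairingD.
rewrite {1}/pairing !mulmxA aB !mul0mx mxE add0r -mulmxA Bx -scalemxAr pairingZ.
by rewrite /pairing -!mulmxA Bb !mulmx0 mxE mulr0.
Qed.

(** Modes [c.*2] and [c.*2.+1] carry the two copies of generator [c]. Interleaving them lets each
    product [e c *m f c] fill two neighbouring modes, without sign. *)
Let dd := (2 * H)%N.
Let e c := cr dd c.*2.
Let f c := cr dd c.*2.+1.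
Let S i := S0 i./2.
Let Phi x := pairing (bra dd S) x (vac dd).
(** Two bases of the second copy: [k = 1] yields [q c - p c], the original one, and [k = 0] yields
    [q c]. *)
Let fk (k : rat) c := f c - k *: e c.

Let Se c : S c.*2 = S0 c. Proof. by rewrite /S doubleK. Qed.
Let Sf c : S c.*2.+1 = S0 c. Proof. by rewrite /S /= uphalf_double. Qed.

Let ee c d : acomm (e c) (e d) = 0. Proof. exact: cr_cr. Qed.
Let ff c d : acomm (f c) (f d) = 0. Proof. exact: cr_cr. Qed.
Let ef c d : acomm (e c) (f d) = 0. Proof. exact: cr_cr. Qed.

Let efk k c d : acomm (e c) (fk k d) = 0.
Proof. by rewrite acommBr acommZr ee ef scaler0 subrr. Qed.

Let fkfk k c d : acomm (fk k c) (fk k d) = 0.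
Proof.
rewrite acommBr acommZr (acomm_sym _ (e d)) efk acomm_sym acommBr acommZr ff.
by rewrite acomm_sym ef !(scaler0, subrr).
Qed.

Let an_e i d : (d < H)%N -> acomm (an dd i) (e d) = (i == d.*2)%:R%:M.
Proof. by move=> dH; apply: an_cr; rewrite /dd; lia. Qed.

Let an_f i d : (d < H)%N -> acomm (an dd i) (f d) = (i == d.*2.+1)%:R%:M.
Proof. by move=> dH; apply: an_cr; rewrite /dd; lia. Qed.

(** The change of basis has determinant 1: since [e c *m e c = 0], the term [k *: e c] disappears
    next to [e c]. *)
Let basis_pairing k :
  Phi (dprod H (sel S0 e) *m iprod H (sel S0 (fk k))) = 1.
Proof.
have ekf c : e c *m fk k c = e c *m f c.
  by rewrite mulmxBr -scalemxAr (acomm_sqr (ee c c)) scaler0 subr0.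
rewrite dprod_iprod => [|c d _]; last first.
  rewrite /sel; case: (S0 d); case: (S0 c);
    rewrite ?(mulmx1, mul1mx) //.
  by apply: comm_pair.
rewrite (@eq_dprod _ _ _ (sel S0 (fun c => e c *m f c))) => [|c _]; last first.
  by rewrite /sel; case: ifP; rewrite ?mulmx1.
(* The pairs [e c *m f c] are even, so their order can be reversed; [bra] then loses its modes from
   the lowest one upwards. *)
have -> n : dprod n (sel S0 (fun c => e c *m f c)) = iprod n (sel S0 (fun c => e c *m f c)).
  elim: n => //= n <-; rewrite comm_dprod // => c _; rewrite /sel.
  case: (S0 c); case: (S0 n); rewrite ?(mulmx1, mul1mx) //.
  have fe : acomm (f c) (e n) = 0 by rewrite acomm_sym ef.
  by rewrite [LHS]mulmxA (comm_pair (ee c n) fe) -[LHS]mulmxA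
    (comm_pair (ef c n) (ff c n)) mulmxA.
have braE n : (n <= H)%N -> bra dd S *m iprod n (sel S0 (fun c => e c *m f c)) =
    bra dd (fun i => S i && (n.*2 <= i)%N).
  elim: n => [|n IH] nH /=.
    by rewrite mulmx1; apply: eq_bra => i _; rewrite andbT.
  rewrite mulmxA (IH (ltnW nH)) /sel.
  case: ifP => Sn; last first.
    rewrite mulmx1; apply: eq_bra => i _.
    case Si: (S i) => //=; rewrite doubleS.
    have : i./2 != n by apply: contraFN Sn => /eqP <-.
    by move=> iN; apply/idP/idP; lia.
  rewrite mulmxA bra_cr_min; [|rewrite /dd; lia| |by rewrite Se Sn /=]; last first.
    by move=> i lin; rewrite negb_and; apply/orP; right; lia.
  rewrite bra_cr_min; [|rewrite /dd; lia| |]; last by rewrite Sf Sn /=; lia.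
    by apply: eq_bra => i _; case: (S i) => //=; lia.
  by move=> i lin; rewrite !negb_and; lia.
rewrite /Phi /pairing braE // (eq_bra (S' := pred0)) ?bra_vac ?mxE // => i idd.
by rewrite leqNgt -mul2n idd andbF.
Qed.

(** Since [represents] allows any [a] and [b], the second product is first absorbed into the vacuum,
    which brings out [ZA X]. Transposition then exchanges the roles: the product of the [e c] is
    absorbed into the other vector and [ZB Y] comes out. *)
Let pairing_reps k ZA ca ZB cb X Y : represents ZA ca -> represents ZB cb ->
  X \in subseqs H -> Y \in subseqs H ->
  Phi (dprod H (sel (mem X) (vec e ca)) *m iprod H (sel (mem Y) (vec (fk k) cb))) = ZA X * ZB Y.
Proof.
move=> repA repB XS YS.
(* This combination is still dual to [e c], but it anticommutes with every [fk k d], the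
   contributions [-k] and [k] cancelling; hence it passes the absorbed product. *)
have BR c : (c < H)%N -> S0 c -> (an dd c.*2 + k *: an dd c.*2.+1) *m
    (iprod H (sel (mem Y) (vec (fk k) cb)) *m vac dd) = 0.
  move=> cH Sc; have [s Bs] : gcomm (an dd c.*2 + k *: an dd c.*2.+1)
      (iprod H (sel (mem Y) (vec (fk k) cb))).
    apply: gcomm_iprod => c' _; rewrite /sel; case: ifP => _; last exact: gcomm1.
    apply/gcomm_acomm/acomm_vec => d dH _.
    rewrite acommDl (acomm_sym (_ *: _)) acommZr (acomm_sym (fk _ _)) !acommBr !acommZr.
    rewrite !an_e // !an_f // !eqSS.
    have -> : (c.*2 == d.*2.+1) = false by lia.
    have -> : (c.*2.+1 == d.*2) = false by lia.
    by rewrite raddf0 scaler0 subr0 sub0r addNr.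
  rewrite mulmxA Bs -scalemxAl -mulmxA mulmxDl -scalemxAl !an_vac.
  by rewrite scaler0 addr0 mulmx0 scaler0.
rewrite /Phi pairing_mulr -repA //; last first.
  split=> [//|c cH Sc]; exists (an dd c.*2 + k *: an dd c.*2.+1); split.
  - rewrite acommDl (acomm_sym (_ *: _)) acommZr (acomm_sym (e _)) !an_e // eqxx.
    have -> : (c.*2.+1 == c.*2) = false by lia.
    by rewrite raddf0 scaler0 addr0.
  - by rewrite mulmxDr -scalemxAr !bra_an ?Se ?Sf // scaler0 addr0.
  - exact: BR.
  - move=> d dH dc; rewrite acommDl (acomm_sym (_ *: _)) acommZr (acomm_sym (e _)) !an_e //.
    have -> : (c.*2.+1 == d.*2) = false by lia.
    have -> : (c.*2 == d.*2) = false by apply: contraNF dc; lia.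
    by rewrite raddf0 scaler0 addr0.
suff -> : pairing (bra dd S) (dprod H (sel S0 e))
    (iprod H (sel (mem Y) (vec (fk k) cb)) *m vac dd) = ZB Y by [].
rewrite -pairing_mulr pairing_tr.
have trI F : (iprod H F)^T = dprod H (fun c => (F c)^T) :> 'M_(fdim dd).
  by apply: trmx_inj; rewrite tr_dprod trmxK; apply: eq_iprod => c _; rewrite trmxK.
have selT Z (F : nat -> 'M[rat]_(fdim dd)) :
    dprod H (fun c => (sel Z F c)^T) = dprod H (sel Z (fun c => (F c)^T)).
  by apply: eq_dprod => c _; rewrite /sel; case: ifP; rewrite ?trmx1.
have vecT c : (vec (fk k) cb c)^T = vec (fun c => (fk k c)^T) cb c.
  by rewrite linear_sum; apply: eq_bigr => d _; rewrite /= linearZ.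
rewrite trI selT (@eq_dprod _ _ _ (sel (mem Y) (vec (fun c => (fk k c)^T) cb))).
  2: by move=> c _; rewrite /sel vecT.
rewrite -repB //.
  rewrite -selT -trI -pairing_tr -/(Phi _) basis_pairing mulr1.
  by [].
have trac x y : acomm x^T y^T = (acomm x y)^T :> 'M_(fdim dd).
  by rewrite /acomm linearD /= !trmx_mul addrC.
split=> [c d|c cH Sc]; first by rewrite trac fkfk trmx0.
have anfk d : (d < H)%N -> acomm (an dd c.*2.+1) (fk k d) = (c == d)%:R%:M.
  move=> dH; rewrite acommBr acommZr an_f // an_e // eqSS.
  have -> : (c.*2.+1 == d.*2) = false by lia.
  have -> : (c.*2 == d.*2) = (c == d) by apply/idP/idP; lia.
  by rewrite raddf0 scaler0 subr0.
exists (an dd c.*2.+1)^T; split.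
- by rewrite trac anfk // eqxx trmx1.
- by rewrite -trmx_mul an_vac trmx0.
- rewrite -trmx_mul; have [s Es] : exists s : bool, dprod H (sel S0 e) *m an dd c.*2.+1 =
      (-1) ^+ s *: (an dd c.*2.+1 *m dprod H (sel S0 e)).
    apply/gcomm_swap/gcomm_dprod => d dH; rewrite /sel; case: ifP => _; last exact: gcomm1.
    apply: gcomm_acomm; rewrite an_e //.
    have -> : (c.*2.+1 == d.*2) = false by lia.
    by rewrite raddf0.
  by rewrite -mulmxA Es -scalemxAr mulmxA bra_an ?Sf // mul0mx scaler0 trmx0.
- by move=> d dH dc; rewrite trac anfk // eq_sym (negbTE dc) raddf0 trmx0.
Qed.

(* The number operator counting the [f]'s minus the [e]'s. *)
Let D := \sum_(c < H) (f c *m an dd c.*2.+1 - e c *m an dd c.*2).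

Let number_comm g a x s : acomm a x = s%:M -> acomm g x = 0 ->
  g *m a *m x - x *m (g *m a) = s *: g :> 'M[rat]_(fdim dd).
Proof.
move=> ax gx; rewrite -mulmxA; have -> : a *m x = s%:M - x *m a by rewrite -ax addrK.
by rewrite mulmxBr mul_mx_scalar !mulmxA (acommE gx) mulNmx opprK addrK.
Qed.

Let degree x (l : rat) := D *m x - x *m D = l *: x.

Let degreeM x y k l : degree x k -> degree y l -> degree (x *m y) (k + l).
Proof.
move=> dx dy; rewrite /degree scalerDl.
have -> : k *: (x *m y) = D *m x *m y - x *m D *m y by rewrite scalemxAl -dx mulmxBl.
have -> : l *: (x *m y) = x *m D *m y - x *m y *m D.
  by rewrite scalemxAr -dy mulmxBr !mulmxA.
by rewrite mulmxA addrA subrK.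
Qed.

Let degreeD x y l : degree x l -> degree y l -> degree (x + y) l.
Proof.
by move=> dx dy; rewrite /degree scalerDr -dx -dy mulmxDl mulmxDr opprD addrACA.
Qed.

Let degree1 : degree 1%:M 0.
Proof. by rewrite /degree mulmx1 mul1mx subrr scale0r. Qed.

Let degree_partial_sum q n l : (forall c, degree (q c) l) -> degree (partial_sum q n) l.
Proof.
move=> dq; elim: n => [|n IH]; rewrite /partial_sum ?big_ord0 ?big_ord_recr /=.
  by rewrite /degree mulmx0 mul0mx subrr scaler0.
by apply: degreeD.
Qed.

Let degree_f c : (c < H)%N -> degree (f c) 1.
Proof.
move=> cH; rewrite /degree mulmx_suml mulmx_sumr -sumrB (bigD1 (Ordinal cH)) //= big1.
  rewrite addr0 mulmxBl mulmxBr opprD addrACA -opprD (number_comm (an_f _ cH)) ?ff // eqxx.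
  rewrite (number_comm (an_f _ cH)) ?ef //.
  have -> : (c.*2 == c.*2.+1) = false by lia.
  by rewrite scale0r subr0.
move=> d dc; rewrite mulmxBl mulmxBr opprD addrACA -opprD.
rewrite (number_comm (an_f _ cH)) ?ff // (number_comm (an_f _ cH)) ?ef //.
have -> : (d.*2 == c.*2.+1) = false by lia.
have -> : (d.*2.+1 == c.*2.+1) = false.
  by rewrite eqSS; apply: contraNF dc => dc; apply/eqP/val_inj => /=; lia.
by rewrite !scale0r subr0.
Qed.

Let degree_e c : (c < H)%N -> degree (e c) (-1).
Proof.
move=> cH; rewrite /degree mulmx_suml mulmx_sumr -sumrB (bigD1 (Ordinal cH)) //= big1.
  rewrite addr0 mulmxBl mulmxBr opprD addrACA -opprD (number_comm (an_e _ cH)) 1?acomm_sym ?ef //.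
  rewrite (number_comm (an_e _ cH)) ?ee // eqxx.
  have -> : (c.*2.+1 == c.*2) = false by lia.
  by rewrite scale0r sub0r scaleN1r scale1r.
move=> d dc; rewrite mulmxBl mulmxBr opprD addrACA -opprD.
rewrite (number_comm (an_e _ cH)) 1?acomm_sym ?ef // (number_comm (an_e _ cH)) ?ee //.
have -> : (d.*2.+1 == c.*2) = false by lia.
have -> : (d.*2 == c.*2) = false.
  by apply: contraNF dc => dc; apply/eqP/val_inj => /=; lia.
by rewrite !scale0r subr0.
Qed.

Let degree_vec g cf l c : (forall d, (d < H)%N -> degree (g d) l) -> degree (vec g cf c) l.
Proof.
by move=> dg; apply: comm_vec.
Qed.

(** [D] kills both vectors, so [l * Phi x] is the value of [Phi] on [D *m x - x *m D], which is 0.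
    On [bra], every height in [S0] holds one [e] and one [f], whose counts cancel. *)
Let degree0 x l : degree x l -> l != 0 -> Phi x = 0.
Proof.
move=> dx l0; have braD : bra dd S *m D = 0.
  rewrite mulmx_sumr big1 // => c _; rewrite mulmxBr.
  have cH : (c < H)%N by [].
  case Sc: (S0 c); last by rewrite !mulmxA !bra_cr ?Se ?Sf ?Sc // !mul0mx subrr.
  have -> : f c *m an dd c.*2.+1 = 1%:M - an dd c.*2.+1 *m f c.
    by have := an_f c.*2.+1 cH; rewrite eqxx /acomm => <-; rewrite addrAC subrr add0r.
  have -> : e c *m an dd c.*2 = 1%:M - an dd c.*2 *m e c.
    by have := an_e c.*2 cH; rewrite eqxx /acomm => <-; rewrite addrAC subrr add0r.
  by rewrite !mulmxBr !mulmxA !bra_an ?Se ?Sf ?Sc // !mul0mx subrr.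
have Dvac : D *m vac dd = 0.
  by rewrite mulmx_suml big1 // => c _; rewrite mulmxBl -!mulmxA !an_vac !mulmx0 subrr.
apply: (mulfI l0); rewrite mulr0 -pairingZ -dx.
rewrite -[- _]scaleN1r pairingD pairingZ /pairing !mulmxA braD !mul0mx.
by rewrite -!mulmxA Dvac !mulmx0 mxE add0r mulr0.
Qed.

(** From a natural degree [l], a factor [q c] only leads to positive degrees, where [Phi]
    vanishes. *)
Let degree_iprod n (q : nat -> 'M_(fdim dd)) x (l : nat) :
  (forall c, degree (q c) 1) -> degree x l%:R ->
  Phi (iprod n (fun c => 1%:M + q c) *m x) = Phi x.
Proof.
move=> dq; elim: n x l => [|n IH] x l dx /=; first by rewrite mul1mx.
have dqx : degree (q n *m x) l.+1%:R.
  by rewrite -addn1 natrD addrC; apply: degreeM.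
rewrite -mulmxA mulmxDl mul1mx mulmxDr /Phi pairingD -/(Phi _) -/(Phi _).
by rewrite (IH _ l) // (IH _ l.+1) // [X in _ + X](degree0 dqx) ?addr0 // pnatr_eq0.
Qed.

(** The square expands over two independent sets, with [fk 1] for the second copy; in the diagonal
    sum the two vectors of a height stand side by side, the second one written with [fk 0]. Both are
    values of [Phi], compared by [pair_identity]. *)
Lemma sqr_sum_represents ZA ca ZB cb : represents ZA ca -> represents ZB cb ->
  (forall d c, (d < H)%N -> (c < H)%N -> S0 d -> cb d c = ca d c + 2 * \sum_(i < c) ca d i) ->
  (\sum_(X <- subseqs H) ZA X) ^+ 2 = \sum_(X <- subseqs H) ZA X * ZB X.
Proof.
move=> repA repB cab; pose p := vec e ca; pose q := vec f ca.
have pp c d : acomm (p c) (p d) = 0 by exact: acomm_vec2.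
have pq c d : acomm (p c) (q d) = 0 by exact: acomm_vec2.
have qq c d : acomm (q c) (q d) = 0 by exact: acomm_vec2.
have f0 c : fk 0 c = f c by rewrite /fk scale0r subr0.
have cumE c : (c < H)%N -> vec (fk 0) cb c = cumul q c.
  move=> cH; rewrite /cumul /partial_sum /q /vec exchange_big /= scaler_sumr -big_split /=.
  apply: eq_bigr => d Sd; rewrite f0 cab // scalerDl mulr_sumr scaler_suml scaler_sumr.
  by congr (_ + _); apply: eq_bigr => i _; rewrite scalerA.
have Pc c : (c < H)%N -> vec (fk 1) ca c = q c - p c.
  move=> _; rewrite /q /p /vec -sumrB; apply: eq_bigr => d _.
  by rewrite /fk scale1r scalerBr.
have RHS1 : \sum_(X <- subseqs H) ZA X * ZB X = Phi (dprod H (fun c => 1%:M + p c *m cumul q c)).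
  rewrite dprod_subseqs /Phi pairing_sum big_seq [RHS]big_seq; apply: eq_bigr => X XS.
  rewrite -(pairing_reps 0 repA repB XS XS) dprod_iprod => [|c d /andP[dc cH]].
    congr pairing; apply: eq_dprod => c cH; rewrite /sel; case: ifP => _; rewrite ?mulmx1 //.
    by rewrite cumE.
  rewrite /sel; case: (mem X d); case: (mem X c); rewrite ?(mulmx1, mul1mx) //.
  by apply: comm_pair; apply: acomm_vec2.
have LHS1 : (\sum_(X <- subseqs H) ZA X) ^+ 2 =
    Phi (dprod H (fun c => 1%:M + p c) *m iprod H (fun c => 1%:M + (q c - p c))).
  rewrite (@eq_iprod _ _ _ (fun c => 1%:M + vec (fk 1) ca c)) => [|c cH]; last by rewrite Pc.
  rewrite dprod_subseqs iprod_subseqs mulmx_suml /Phi pairing_sum expr2 mulr_suml.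
  rewrite big_seq [RHS]big_seq; apply: eq_bigr => X XS.
  rewrite mulmx_sumr pairing_sum mulr_sumr big_seq [RHS]big_seq; apply: eq_bigr => Y YS.
  by rewrite -(pairing_reps 1 repA repA XS YS).
rewrite LHS1 RHS1 pair_identity //; apply: (@degree_iprod H q _ 0%N).
  by move=> c; apply: degree_vec.
have degcum c : degree (cumul q c) 1.
  apply: degreeD; first exact: degree_vec.
  rewrite /degree -scalemxAl -scalemxAr -scalerBr.
  rewrite (@degree_partial_sum _ _ 1) ?scalerA 1?mulrC //.
  by move=> d; apply: degree_vec.
elim: {1}H => [|n IH] //=; rewrite -[_%:R]addr0; apply: degreeM => //.
apply: degreeD; first exact: degree1.
rewrite -[_%:R](addNr 1); apply: degreeM => //.
exact: degree_vec.
Qed.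

End Representation.

(** * Lozenge tilings *)

Lemma card_fset3I (K : choiceType) (x y z : K) (V : {fset K}) :
  uniq [:: x; y; z] ->
  #|` [fset x; y; z] `&` V| = ((x \in V) + (y \in V) + (z \in V))%N.
Proof.
move=> uxyz; have -> : [fset x; y; z] `&` V = seq_fset tt [seq v <- [:: x; y; z] | v \in V].
  by apply/fsetP => v; rewrite seq_fsetE mem_filter !inE andbC orbA.
rewrite size_seq_fset undup_id ?filter_uniq // size_filter /=.
by rewrite addn0 addnA.
Qed.

Lemma share_edgeC t u : share_edge t u = share_edge u t.
Proof. by rewrite /share_edge fsetIC. Qed.

Lemma eq_shift (a x : int) :
  ((a == a + x) = (x == 0)) * ((a == a + x + 1) = (x == -1)) *
  ((a + 1 == a + x) = (x == 1)) * ((a + 1 == a + x + 1) = (x == 0)) *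
  ((a + x == a) = (x == 0)) * ((a + x == a - 1) = (x == -1)).
Proof. by do !split; apply/eqP/eqP; lia. Qed.

Lemma share_edge_RL a b a' b' : share_edge (Rtri a b) (Ltri a' b') =
  [|| (a' == a) && (b' == b), (a' == a) && (b' == b - 1) | (a' == a - 1) && (b' == b)].
Proof.
(* Adjacency is translation invariant: only the differences [x], [y] matter, and beyond a few small
   values all vertex comparisons compute to false. *)
rewrite -(subrK a a') -(subrK b b') (addrC _ a) (addrC _ b).
move: (a' - a : int) (b' - b : int) => x y.
rewrite /share_edge /= card_fset3I; last by rewrite /= !inE !xpair_eqE; lia.
rewrite !inE !xpair_eqE !eq_shift.
by case: x => [[|[|x]]|[|x]]; case: y => [[|[|y]]|[|y]].
Qed.

Lemma share_edge_RR a b a' b' : share_edge (Rtri a b) (Rtri a' b') =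
  false.
Proof.
rewrite -(subrK a a') -(subrK b b') (addrC _ a) (addrC _ b).
move: (a' - a : int) (b' - b : int) => x y.
rewrite /share_edge /= card_fset3I; last by rewrite /= !inE !xpair_eqE; lia.
rewrite !inE !xpair_eqE !eq_shift.
by case: x => [[|[|x]]|[|x]]; case: y => [[|[|y]]|[|y]].
Qed.

Lemma share_edge_LL a b a' b' : share_edge (Ltri a b) (Ltri a' b') =
  false.
Proof.
rewrite -(subrK a a') -(subrK b b') (addrC _ a) (addrC _ b).
move: (a' - a : int) (b' - b : int) => x y.
rewrite /share_edge /= card_fset3I; last by rewrite /= !inE !xpair_eqE; lia.
rewrite !inE !xpair_eqE !eq_shift.
by case: x => [[|[|x]]|[|x]]; case: y => [[|[|y]]|[|y]].
Qed.

Lemma share_edge_irr t : share_edge t t = false.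
Proof. by case: t => a b; rewrite ?share_edge_RR ?share_edge_LL. Qed.

Lemma tilingP S T : reflect
  [/\ forall l, l \in T -> is_lozenge l /\ l `<=` S,
      forall l l' t, l \in T -> l' \in T -> t \in l -> t \in l' -> l = l' &
      forall t, t \in S -> exists2 l, l \in T & t \in l]
  (T \in tilings S).
Proof.
rewrite in_tilings; apply: (iffP and3P) => [[/fsubsetP Tl /trivIfsetP Td /eqP TS]|[Tl Td TS]].
  split=> [l /Tl|l l' t lT l'T tl tl'|t]; first by rewrite in_lozenges_in => /andP[].
    apply: contraTeq tl' => ll'; have := fdisjointP (Td _ _ lT l'T ll') t tl; exact.
  by rewrite -TS => /bigfcupP[l /andP[lT _] tl]; exists l.
split; first by apply/fsubsetP => l /Tl; rewrite in_lozenges_in => -[-> ->].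
  apply/trivIfsetP => l l' lT l'T ll'; apply/fdisjointP => t tl.
  by apply: contra ll' => tl'; rewrite (Td l l' t).
apply/eqP/fsetP => t; apply/bigfcupP/idP => [[l /andP[lT _] tl]|/TS[l lT tl]].
  by have [_ /fsubsetP] := Tl _ lT; apply.
by exists l; rewrite ?lT.
Qed.

Lemma lozenge_neq0 l : is_lozenge l -> exists t, t \in l.
Proof. by case/is_lozengeP => t [u [_ ->]]; exists t; rewrite !inE eqxx. Qed.

Lemma tilings_notin S T l : is_lozenge l -> T \in tilings (S `\` l) -> l \notin T.
Proof.
move=> /lozenge_neq0[t tl] /tilingP[Tl _ _]; apply/negP => /Tl[_ /fsubsetP/(_ _ tl)].
by rewrite inE tl.
Qed.

Lemma tilings_add S l : is_lozenge l -> l `<=` S ->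
  [fset T in tilings S | l \in T] = [fset l |` T | T in tilings (S `\` l)].
Proof.
move=> lz /fsubsetP lS; apply/fsetP => T; rewrite inE /=.
apply/andP/imfsetP => [[TS lT]|[T' T'S ->]].
  have /tilingP[Tl Td Tc] := TS.
  suff ? : T `\ l \in tilings (S `\` l) by exists (T `\ l); rewrite ?fsetD1K.
  apply/tilingP; split=> [l'|l1 l2 t|t].
  - rewrite !inE => /andP[l'l l'T]; have [l'z /fsubsetP l'S] := Tl _ l'T; split=> //.
    apply/fsubsetP => t tl'; rewrite inE l'S // andbT; apply: contra l'l => tl.
    by rewrite (Td l' l t).
  - by rewrite !inE => /andP[_ l1T] /andP[_ l2T]; apply: Td.
  - rewrite inE => /andP[tl /Tc[l' l'T tl']]; exists l' => //.
    by rewrite !inE l'T andbT; apply: contraNneq tl => <-.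
split; last by rewrite !inE eqxx.
have /tilingP[Tl Td Tc] := T'S.
have disj l' t : l' \in T' -> t \in l -> t \in l' -> False.
  by move=> /Tl[_ /fsubsetP l'S] tl /l'S; rewrite inE tl.
apply/tilingP; split=> [l'|l1 l2 t|t tS].
- rewrite !inE => /orP[/eqP -> //|/Tl[l'z l'S]]; first by split=> //; apply/fsubsetP.
  by split=> //; apply: fsubset_trans l'S (fsubsetDl _ _).
- rewrite !inE => /orP[/eqP ->|l1T] /orP[/eqP ->|l2T] // t1 t2.
  + by case: (disj _ _ l2T t1 t2).
  + by case: (disj _ _ l1T t2 t1).
  + exact: (Td _ _ t).
- have [tl|tl] := boolP (t \in l); first by exists l; rewrite ?inE ?eqxx.
  by have [|l' l'T tl'] := Tc t; rewrite ?inE ?tl //; exists l'; rewrite ?inE ?l'T ?orbT.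
Qed.

Lemma lozenge_pair t u : share_edge t u -> is_lozenge [fset t; u].
Proof. by move=> tu; apply/is_lozengeP; exists t, u. Qed.

Lemma lozenge_at l t : is_lozenge l -> t \in l -> exists2 u, share_edge t u & l = [fset t; u].
Proof.
move=> /is_lozengeP[x [y [xy ->]]]; rewrite !inE => /orP[]/eqP ->; first by exists y.
by exists x; [rewrite share_edgeC | rewrite fsetUC].
Qed.

Lemma pair_inj (t u v : triangle) : [fset t; u] = [fset t; v] -> t != u -> u = v.
Proof.
move=> /fsetP/(_ u); rewrite !inE eqxx orbT => /esym/orP[/eqP ->|/eqP //].
by rewrite eqxx.
Qed.

Lemma share_edge_neq t u : share_edge t u -> t != u.
Proof. by apply: contraTneq => ->; rewrite share_edge_irr. Qed.

Lemma M_expand w S t : t \in S ->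
  M w S = \sum_(u <- S | share_edge t u) w [fset t; u] * M w (S `\` [fset t; u]).
Proof.
move=> tS; rewrite /M.
transitivity (\sum_(T <- tilings S) \sum_(u <- S | share_edge t u)
    if [fset t; u] \in T then \prod_(l <- T) w l else 0).
  rewrite big_seq [RHS]big_seq; apply: eq_bigr => T /tilingP[Tl Td Tc].
  have [l lT tl] := Tc _ tS; have [lz /fsubsetP lS] := Tl _ lT.
  have [u tu lE] := lozenge_at lz tl; rewrite lE in lT tl lS.
  rewrite -[RHS]big_filter [RHS](bigD1_seq u) /=; last 2 first.
  - by rewrite mem_filter tu lS // !inE eqxx orbT.
  - by rewrite filter_uniq ?fset_uniq.
  rewrite lT [X in _ + X]big_seq_cond [X in _ + X]big1 ?addr0 // => v; rewrite mem_filter => /andP[/andP[tv _] vu].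
  case: ifP => // vT; case/eqP: vu; apply/esym/(@pair_inj t); last exact: share_edge_neq.
  by apply: (Td _ _ t) => //; rewrite !inE eqxx.
rewrite exchange_big /=; rewrite big_seq_cond [RHS]big_seq_cond.
apply: eq_bigr => u /andP[uS tu]; rewrite -big_mkcond big_fset_condE tilings_add; first last.
- by apply/fsubsetP => x; rewrite !inE => /orP[]/eqP ->.
- exact: lozenge_pair.
have lz := lozenge_pair tu.
rewrite big_imfset /=; last first.
  move=> T1 T2 /= T1S T2S T12.
  by rewrite -(fsetU1K (tilings_notin lz T1S)) T12 fsetU1K ?(tilings_notin lz T2S).
rewrite mulr_sumr big_seq [RHS]big_seq; apply: eq_bigr => T TS.
by rewrite big_fsetU1 // (tilings_notin lz TS).
Qed.

Lemma M_eq w w' S : (forall l, is_lozenge l -> l `<=` S -> w l = w' l) -> M w S = M w' S.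
Proof.
move=> ww; rewrite /M big_seq [RHS]big_seq; apply: eq_bigr => T /tilingP[Tl _ _].
by rewrite big_seq [RHS]big_seq; apply: eq_bigr => l /Tl[]; apply: ww.
Qed.

Lemma M0 w : M w fset0 = 1.
Proof.
rewrite /M; have -> : tilings fset0 = [fset fset0].
  apply/fsetP => T; rewrite inE; apply/tilingP/eqP => [[Tl _ _]|->]; last by split.
  apply/fsetP => l; rewrite inE; apply/negP => /Tl[/lozenge_neq0[t tl] /fsubsetP/(_ _ tl)].
  by rewrite inE.
by rewrite big_seq_fset1 big_seq_fset0.
Qed.

(** Lozenges joining [A] to [B] may exist provided that their weight is 0; this fits [cut], which
    keeps the axis lozenges and only annuls their weights. *)
Lemma M_disjoint w A B : (forall t u, t \in A -> u \in B -> share_edge t u -> w [fset t; u] = 0) ->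
  [disjoint A & B] -> M w (A `|` B) = M w A * M w B.
Proof.
elim: {A}_.+1 {-2}A (ltnSn #|` A|) => // n IH A cA wAB dAB.
have [->|[t tA]] := fset_0Vmem A; first by rewrite fset0U M0 mul1r.
rewrite (M_expand w tA) (@M_expand _ _ t) ?inE ?tA //.
rewrite mulr_suml.
transitivity (\sum_(u <- A | share_edge t u)  w [fset t; u] * M w ((A `|` B) `\` [fset t; u])).
  rewrite [LHS]big_mkcond [RHS]big_mkcond /=; apply/esym/big_fset_incl; first exact: fsubsetUl.
  move=> u; rewrite inE => /orP[->//|uB] _; case: ifP => // tu.
  by rewrite wAB ?mul0r.
rewrite big_seq_cond [RHS]big_seq_cond; apply: eq_bigr => u /andP[uA tu].
have -> : (A `|` B) `\` [fset t; u] = (A `\` [fset t; u]) `|` B.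
  apply/fsetP => x; rewrite !inE; case xB: (x \in B); rewrite ?orbF // !orbT andbT.
  apply/negP => /orP[]/eqP xE; move/fdisjointP: dAB => /(_ x); rewrite xB xE;
  by rewrite ?tA ?uA => /(_ isT).
rewrite IH ?mulrA //.
- rewrite -ltnS; apply: leq_trans cA; rewrite ltnS; apply: fproper_ltn_card.
  rewrite fproperEneq fsubsetDl andbT; apply/eqP => /fsetP/(_ t).
  by rewrite !inE eqxx tA.
- by move=> x y; rewrite inE => /andP[_]; apply: wAB.
- by apply: fdisjointWl dAB; apply: fsubsetDl.
Qed.

(** Deletion and contraction of an edge of the dual graph. Deletion is expressed by weight 0, since
    which lozenges exist is fixed by the geometry. *)
Lemma M_del_edge w S t u : share_edge t u ->
  M w S = M (fun l => if l == [fset t; u] then 0 else w l) S +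
    (if (t \in S) && (u \in S) then w [fset t; u] * M w (S `\` [fset t; u]) else 0).
Proof.
move=> tu; set w' := fun l => _; have w'E (R : {fset triangle}) : ~~ ([fset t; u] `<=` R) -> M w' R = M w R.
  move=> nR; apply: M_eq => l _ lR; rewrite /w'; case: eqP => // lE.
  by rewrite lE in lR; rewrite lR in nR.
have [tS|tS] := boolP (t \in S); last first.
  rewrite addr0 w'E //; apply: contra tS => /fsubsetP; apply.
  by rewrite !inE eqxx.
have [uS|uS] /= := boolP (u \in S); last first.
  rewrite addr0 w'E //; apply: contra uS => /fsubsetP; apply.
  by rewrite !inE eqxx orbT.
rewrite !(M_expand _ tS) -!(big_filter (enum_fset S)).
have uF : u \in [seq v <- S | share_edge t v] by rewrite mem_filter tu.
rewrite !(bigD1_seq u) ?filter_uniq ?fset_uniq //= {1}/w' eqxx mul0r add0r addrC; congr (_ + _).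
rewrite big_seq_cond [RHS]big_seq_cond; apply: eq_bigr => v.
rewrite mem_filter => /andP[/andP[tv _] vu]; congr (_ * _).
  rewrite /w' ifF //; apply: contraNF vu => /eqP/pair_inj -> //; exact: share_edge_neq.
rewrite w'E //; apply/negP => /fsubsetP/(_ t); rewrite !inE eqxx => /(_ isT).
by [].
Qed.

(** * Cutting tilings along the axis *)

Definition cross (c : nat) : {fset triangle} := [fset Ltri (-1) c%:Z; Rtri 0 c%:Z].

Definition strip (S : {fset triangle}) (X : seq nat) : {fset triangle} :=
  [fset t in S | ~~ has (fun c => t \in cross c) X].

Definition cut (w : {fset triangle} -> rat) n l : rat :=
  if has (fun c => l == cross c) (iota 0 n) then 0 else w l.

Lemma cross_edge c : share_edge (Ltri (-1) c%:Z) (Rtri 0 c%:Z).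
Proof. by rewrite share_edgeC share_edge_RL; lia. Qed.

Lemma cross_inj : injective cross.
Proof.
move=> c d /fsetP/(_ (Rtri 0 c%:Z)); rewrite !inE eqxx orbT => /esym/orP[]/eqP //.
by case.
Qed.

Lemma in_strip S X t : (t \in strip S X) = (t \in S) && ~~ has (fun c => t \in cross c) X.
Proof. by rewrite !inE. Qed.

Lemma mem_cross_eq c d t : t \in cross c -> t \in cross d -> c = d.
Proof. by rewrite !inE => /orP[]/eqP -> /orP[]/eqP // []. Qed.

(** Deletion and contraction of the axis lozenges, one height after the other; [X] records the
    contracted ones. *)
Lemma M_cross w S n : (forall c, (c < n)%N -> w (cross c) = 1) ->
  M w S = \sum_(X <- subseqs n)
    if all (fun c => cross c `<=` S) X then M (cut w n) (strip S X) else 0.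
Proof.
elim: n => [|n IH] w1 /=.
  rewrite big_seq1 /=; have -> : strip S [::] = S by apply/fsetP => t; rewrite in_strip andbT.
  by apply: M_eq.
rewrite big_cat big_map /= -big_split IH => [|c cn]; last by apply: w1; apply: ltnW.
rewrite big_seq [RHS]big_seq; apply: eq_bigr => X XS /=.
case: ifP => Xall; last by rewrite andbF addr0.
have nX t : t \in cross n -> ~~ has (fun c => t \in cross c) X.
  move=> tn; apply/hasPn => c cX; apply/negP => /(mem_cross_eq tn) nc.
  by have := subseqs_lt XS cX; rewrite -nc ltnn.
have cutS l : cut w n.+1 l = if l == cross n then 0 else cut w n l.
  by rewrite /cut -[n.+1]addn1 iotaD has_cat /= add0n orbF orbC; case: (l == _).
rewrite (M_del_edge (cut w n) (strip S X) (cross_edge n)) -/(cross n).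
rewrite (@M_eq _ (cut w n.+1)) => [|l _ _]; last by rewrite cutS.
rewrite andbT; congr (_ + _).
rewrite !in_strip !nX ?inE ?eqxx ?orbT // !andbT.
have -> : (cross n `<=` S) = (Ltri (-1) n%:Z \in S) && (Rtri 0 n%:Z \in S).
  apply/fsubsetP/andP => [nS|[nL nR] t]; first by split; apply: nS; rewrite !inE eqxx ?orbT.
  by rewrite !inE => /orP[]/eqP ->.
case: ifP => // _.
have -> : cut w n (cross n) = 1.
  rewrite /cut ifF ?w1 //; apply/negP => /hasP[c]; rewrite mem_iota add0n => /andP[_ cn] /eqP/cross_inj nc.
  by rewrite nc ltnn in cn.
rewrite mul1r (_ : strip S X `\` cross n = strip S (n :: X)).
  apply: M_eq => l lz lS; rewrite cutS; case: eqP => // ln.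
  have : Rtri 0 n%:Z \in strip S (n :: X) by apply: (fsubsetP lS); rewrite ln !inE eqxx orbT.
  by rewrite in_strip /= !inE eqxx orbT /= andbF.
by apply/fsetP => t; rewrite in_fsetD !in_strip /= negb_or; case: (t \in cross n); rewrite ?andbF.
Qed.

Lemma M1_card S : M (fun=> 1) S = #|` tilings S|%:R.
Proof.
by rewrite /M; under eq_bigr do rewrite big1_eq; rewrite card_fset_sum1 natr_sum.
Qed.

Definition axis_right (X : seq nat) : {fset triangle} := [fset Rtri 0 (c%:Z) | c in X].

Lemma in_axis_right X a c : (Rtri a c \in axis_right X) = (a == 0) && (c \in [seq x%:Z | x <- X]).
Proof.
apply/imfsetP/andP => [[x xX [-> ->]]|[/eqP -> /mapP[x xX ->]]]; last by exists x.
by split=> //; apply: map_f.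
Qed.

Definition left_half (S : {fset triangle}) :=
  forall t, t \in S -> match t with Rtri a _ | Ltri a _ => a < 0 end.

Lemma left_half_axis S X t : left_half S -> t \in S -> (t \in axis_right X) = false.
Proof. by move=> lS /lS t0; apply/negP => /imfsetP[c _ tE]; rewrite tE in t0. Qed.

(** Of the three neighbours of R(0,c), only L(-1,c) lies left of the axis, so the lozenge [cross c]
    is forced. *)
Lemma M_axis_right S X : left_half S -> uniq X -> M (fun=> 1) (S `|` axis_right X) =
  if all (fun c : nat => Ltri (-1) c%:Z \in S) X then M (fun=> 1) (strip S X) else 0.
Proof.
elim: X S => [|c X IH] S lS /=.
  move=> _; have -> : strip S [::] = S by apply/fsetP => t; rewrite in_strip andbT.
  by have -> : S `|` axis_right [::] = S by apply/fsetP => t; rewrite inE orbC (_ : _ \in axis_right _ = false) //; apply/negP => /imfsetP[].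
move=> /andP[cX uX]; set S' := S `|` _.
have RS : Rtri 0 c%:Z \in S' by rewrite inE in_axis_right /= inE !eqxx orbT.
rewrite (M_del_edge _ S' (cross_edge c)) -/(cross c) mul1r RS andbT.
have LS' : (Ltri (-1) c%:Z \in S') = (Ltri (-1) c%:Z \in S).
  by rewrite inE orbC; case: (_ \in axis_right _) / imfsetP => // -[].
rewrite LS' (M_expand _ RS) big_seq_cond big1 ?add0r => [|u /andP[uS' Ru]]; last first.
  rewrite ifT ?mul0r //; apply/eqP.
  case: u uS' Ru => a b; first by rewrite share_edge_RR.
  rewrite inE orbC; case: (_ \in axis_right _) / imfsetP => [[]//|_] /= /lS a0.
  rewrite share_edge_RL => /or3P[]/andP[/eqP aE /eqP ->]; rewrite aE ?sub0r in a0 *; try by move: a0; lia.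
  by rewrite fsetUC.
case: ifP => //= cS.
have -> : S' `\` cross c = strip S [:: c] `|` axis_right X.
  apply/fsetP => t; rewrite in_fsetD [RHS]in_fsetU in_strip has_seq1.
  move tcE : (t \in cross c) => tc; rewrite /S' in_fsetU; case tS: (t \in S).
    by rewrite orTb andbT andTb (left_half_axis _ lS tS) orbF.
  rewrite orFb andFb orFb; case: t tS tcE => a b tS <-; last first.
    have N Z : Ltri a b \in axis_right Z = false by apply/negP => /imfsetP[].
    by rewrite !N andbF.
  rewrite !in_axis_right map_cons in_cons andb_orr.
  have -> : (Rtri a b \in cross c) = (a == 0) && (b == c%:Z).
    rewrite !inE; apply/orP/andP => [[/eqP//|/eqP[-> ->]]|[/eqP -> /eqP ->]]; first by rewrite !eqxx.
    by right.
  case: eqP => //= _; case: eqP => //= ->.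
  by rewrite mem_map ?(negbTE cX) // => x y [].
rewrite IH // => [|t]; last by rewrite in_strip => /andP[/lS].
have -> : strip (strip S [:: c]) X = strip S (c :: X).
  by apply/fsetP => t; rewrite !in_strip /= orbF negb_or andbA.
congr (if _ then _ else _); apply: eq_in_all => x xX; rewrite in_strip /= orbF.
rewrite -[RHS]andbT; congr (_ && _); apply/negP => xc.
have := @mem_cross_eq x c (Ltri (-1) x%:Z); rewrite xc !inE eqxx => /(_ isT isT) xc'.
by rewrite -xc' xX in cX.
Qed.

Lemma subseqs_uniq n : uniq (subseqs n).
Proof.
elim: n => //= n IH; rewrite cat_uniq IH map_inj_uniq ?IH => [|x y [] //]; rewrite andbT.
apply/hasPn => _ /mapP[X XS ->]; apply/negP => /subseqs_lt/(_ (mem_head _ _)).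
by rewrite ltnn.
Qed.

Lemma uniq_subseqs n X : X \in subseqs n -> uniq X.
Proof.
elim: n X => [|n IH] X /=; first by rewrite inE => /eqP ->.
rewrite mem_cat => /orP[/IH //|/mapP[Y YS ->]] /=; rewrite (IH _ YS) andbT.
by apply/negP => /(subseqs_lt YS); rewrite ltnn.
Qed.

(** Lists a subset in decreasing order, the order in which [subseqs] enumerates it. *)
Definition down (p : pred nat) n : seq nat := [seq c <- rev (iota 0 n) | p c].

Lemma downS p n : down p n.+1 = if p n then n :: down p n else down p n.
Proof. by rewrite /down -addn1 iotaD rev_cat /= add0n. Qed.

Lemma mem_down p n c : (c \in down p n) = p c && (c < n)%N.
Proof. by rewrite mem_filter mem_rev mem_iota. Qed.

Lemma down_subseqs p n : down p n \in subseqs n.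
Proof.
elim: n => //= n IH; rewrite downS mem_cat; case: ifP => _; last by rewrite IH.
by rewrite map_f ?orbT.
Qed.

Lemma subseqs_down n p X : X \in subseqs n -> (forall c, (c < n)%N -> p c = (c \in X)) ->
  down p n = X.
Proof.
elim: n X => [|n IH] X /=; first by rewrite inE => /eqP ->.
rewrite downS mem_cat => /orP[XS pX|/mapP[Y YS -> pX]].
  rewrite pX // ifF; last by apply/negP => /(subseqs_lt XS); rewrite ltnn.
  by apply: IH => // c cn; apply: pX; apply: ltnW.
rewrite pX // mem_head; congr (_ :: _); apply: IH => // c cn.
rewrite pX; last exact: ltnW.
by rewrite inE ltn_eqF.
Qed.

(** A free tiling is an ordinary tiling of [S] enlarged by the protruding triangles R(0,c).
    Conversely, R(0,c) can only be matched with L(-1,c) there, so no lozenges other than crossing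
    ones protrude. *)
Lemma free_tilings_fiber S n X : left_half S ->
  (forall c, Ltri (-1) c \in S -> exists2 c' : nat, (c' < n)%N & c = c'%:Z) ->
  X \in subseqs n ->
  [fset T in free_tilings S | down (fun c => Rtri 0 c%:Z \in fcover T) n == X] =
  tilings (S `|` axis_right X).
Proof.
move=> lS bS XS; apply/fsetP => T; rewrite in_fset [X in X = _]inE /= in_free_tilings; apply/andP/idP.
  case=> /and3P[/fsubsetP Tl /trivIfsetP Td /fsubsetP ST] /eqP YX.
  have inX (c : nat) : (c < n)%N -> Rtri 0 c%:Z \in fcover T -> c \in X.
    by move=> cn cT; rewrite -YX mem_down cT.
  apply/tilingP; split=> [l lT|l l' t lT l'T tl tl'|t].
  - have := Tl _ lT; rewrite in_fsetU in_lozenges_in => /orP[/andP[lz lS']|].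
      by split=> //; apply: fsubset_trans lS' (fsubsetUl _ _).
    case/crossing_lozengesP => c cS lE; have [c' c'n cE] := bS _ cS.
    rewrite lE cE; split; first exact/lozenge_pair/cross_edge.
    have c'X : c' \in X.
      by apply: inX => //; apply/bigfcupP; exists l; rewrite ?lT // lE cE !inE eqxx orbT.
    apply/fsubsetP => t; rewrite in_fset2 => /orP[]/eqP ->; rewrite in_fsetU -?cE ?cS //.
    by rewrite in_axis_right eqxx cE map_f ?orbT.
  - by apply: contraTeq tl' => ll'; have := fdisjointP (Td _ _ lT l'T ll') t tl; exact.
  - rewrite in_fsetU => /orP[/ST|/imfsetP[c /=]].
      by case/bigfcupP => l /andP[lT _] tl; exists l.
    by rewrite -YX mem_down => /andP[/bigfcupP[l /andP[lT _] tl] _] ->; exists l.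
move=> TS; have /tilingP[Tl Td Tc] := TS.
have /and3P[_ _ /eqP TE] : is_tiling (S `|` axis_right X) T by rewrite -in_tilings.
split; last first.
  apply/eqP/subseqs_down => // c cn; rewrite TE in_fsetU in_axis_right eqxx /=.
  rewrite mem_map => [|x y [] //]; case cS: (_ \in S) => //=.
  by have := lS _ cS.
apply/and3P; split.
- apply/fsubsetP => l lT; have [lz /fsubsetP lS'] := Tl _ lT.
  rewrite in_fsetU in_lozenges_in lz /=.
  have [lSS|/fsubsetPn[t tl tS]] := boolP (l `<=` S) => //=.
  have := lS' _ tl; rewrite in_fsetU (negbTE tS) => /imfsetP[c cX tE].
  rewrite tE in tl; have [u tu lE] := lozenge_at lz tl.
  have uS : u \in S `|` axis_right X by apply: lS'; rewrite lE !inE eqxx orbT.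
  case: u tu lE uS => a b; first by rewrite share_edge_RR.
  rewrite in_fsetU share_edge_RL => ab lE /orP[uS|/imfsetP[] //].
  apply/crossing_lozengesP; exists c%:Z; have := lS _ uS; last first.
    by rewrite lE fsetUC; case/or3P: ab => /andP[/eqP -> /eqP ->] // /=; lia.
  by case/or3P: ab uS => /andP[/eqP -> /eqP ->] // ? /=; lia.
- by have := TS; rewrite in_tilings => /and3P[].
- by rewrite TE fsubsetUl.
Qed.

Lemma Mf_sum S n : left_half S ->
  (forall c, Ltri (-1) c \in S -> exists2 c' : nat, (c' < n)%N & c = c'%:Z) ->
  (Mf S)%:R = \sum_(X <- subseqs n) M (fun=> 1) (S `|` axis_right X).
Proof.
move=> lS bS.
transitivity (\sum_(T <- free_tilings S) \sum_(X <- subseqs n)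
   if down (fun c => Rtri 0 c%:Z \in fcover T) n == X then 1 else 0 : rat).
  rewrite /Mf card_fset_sum1 natr_sum; apply: eq_bigr => T _.
  rewrite (bigD1_seq (down (fun c => Rtri 0 c%:Z \in fcover T) n)) ?subseqs_uniq ?down_subseqs //=.
  by rewrite eqxx big1 ?addr0 // => X; rewrite eq_sym => /negbTE ->.
rewrite exchange_big big_seq [RHS]big_seq; apply: eq_bigr => X XS /=.
rewrite -big_mkcond big_fset_condE free_tilings_fiber // M1_card card_fset_sum1.
by rewrite natr_sum.
Qed.

(** * Growing a half region *)

(* [(b, (j, c))] is the triangle of colour [b] (black if [true]) in column [j] and
   at height [c]; it plays the role of L(j - n0, c) if black and of R(j - n0, c)
   if white, where [n0] is the number of columns. *)
Local Notation vertex := (bool * (nat * nat))%type.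

Definition adjacent (v u : vertex) : bool :=
  let: (b, (j, c)) := if v.1 then u else v in let: (b', (j', c')) := if v.1 then v else u in
  (b != b') && [|| (j' == j) && (c' == c), (j'.+1 == j) && (c' == c) | (j' == j) && (c'.+1 == c)].

Section HalfRegion.
Variables (emb : vertex -> triangle) (w : {fset triangle} -> rat) (n0 H : nat).
Hypothesis emb_inj : injective emb.
Hypothesis emb_adj : forall v u, share_edge (emb v) (emb u) = adjacent v u.

Definition box : {fset bool * (nat * nat)} :=
  [fset (v.1, (val v.2.1, val v.2.2)) | v in [set: bool * ('I_n0 * 'I_H)]].

Lemma in_box b j c : ((b, (j, c)) \in box) = (j < n0)%N && (c < H)%N.
Proof.
apply/imfsetP/andP => [[[b' [j' c']] _ [_ -> ->]] //|[jn cH]].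
by exists (b, (Ordinal jn, Ordinal cH)); rewrite //= inE.
Qed.

Definition region (P : pred vertex) : {fset triangle} :=
  [fset emb v | v in [fset v in box | P v]].

Lemma in_region P v : (emb v \in region P) = (v \in box) && P v.
Proof.
by rewrite mem_imfset ?inE //.
Qed.

Lemma eq_region (P Q : pred vertex) : (forall v, v \in box -> P v = Q v) -> region P = region Q.
Proof.
move=> PQ; rewrite /region; suff -> : [fset v in box | P v] = [fset v in box | Q v] by [].
apply/fsetP => v; rewrite !inE /=.
by case vb: (v \in box) => //=; apply: PQ.
Qed.

Definition remove2 (P : pred vertex) (x y : vertex) : pred vertex :=
  fun v => [&& P v, v != x & v != y].

Lemma region_remove2 P x y : region P `\` [fset emb x; emb y] = region (remove2 P x y).
Proof.
apply/fsetP => t; rewrite !inE; apply/andP/imfsetP => /=.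
  move=> [tn /imfsetP[v]]; rewrite !inE /= => /andP[vb Pv] tE; exists v => //.
  rewrite !inE vb /= /remove2 Pv; move: tn; rewrite negb_or tE.
  by rewrite !(inj_eq emb_inj).
move=> [v]; rewrite !inE /= => /and4P[vb Pv vx vy] ->.
by rewrite in_region vb Pv !(inj_eq emb_inj) negb_or vx vy.
Qed.

Lemma M_region (P : pred vertex) x (cs : seq vertex) : x \in box -> P x -> uniq cs ->
  all (adjacent x) cs ->
  (forall v, v \in box -> P v -> adjacent x v -> v \in cs) ->
  M w (region P) = \sum_(v <- cs) (if (v \in box) && P v
    then w [fset emb x; emb v] * M w (region (remove2 P x v)) else 0).
Proof.
move=> xb Px ucs /allP acs Pcs; rewrite (@M_expand _ _ (emb x)) ?in_region ?xb //.
rewrite big_mkcond {1}/region big_imfset /=; last by move=> v u _ _; apply: emb_inj.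
rewrite -!big_mkcond -[LHS]big_filter -[RHS]big_filter.
rewrite (perm_big [seq v <- cs | (v \in box) && P v]) /=.
  by apply: eq_bigr => v _; rewrite region_remove2.
apply: uniq_perm; rewrite ?filter_uniq ?fset_uniq // => v.
rewrite !mem_filter emb_adj; apply/andP/andP => [[xv]|[/andP[vb Pv] /acs xv]].
  by rewrite !inE /= => /andP[vb Pv]; rewrite vb Pv Pcs.
by rewrite !inE /= vb.
Qed.

Variables (ws : nat -> nat) (S0 : pred nat) (om : rat).
(** First black column at height [c]. A height in [S0] keeps its end triangle, a black one in the
    column before its first white one. *)
Definition bs c := (ws c - S0 c)%N.
Hypothesis ws_gt0 : forall c, (c < H)%N -> S0 c -> (0 < ws c)%N.
Hypothesis w_up : forall j c, (j < n0)%N -> (c < H)%N -> (ws c <= j)%N ->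
  w [fset emb (false, (j, c)); emb (true, (j, c))] = 1.
Hypothesis w_hop : forall j c, (j < n0)%N -> (c.+1 < H)%N -> (ws c.+1 <= j)%N -> (bs c <= j)%N ->
  w [fset emb (false, (j, c.+1)); emb (true, (j, c))] = 1.
Hypothesis w_left : forall j c, (j.+1 < n0)%N -> (c < H)%N -> (ws c <= j.+1)%N -> (bs c <= j)%N ->
  w [fset emb (false, (j.+1, c)); emb (true, (j, c))] =
    (if S0 c && (j.+1 == ws c) then om else 1).

(* [fr c] is the number of columns already filled at height [c]; the black
   triangles on the frontier at the heights in [X] are removed. *)
Definition partial (fr : nat -> nat) (X : pred nat) : pred vertex := fun v =>
  [&& (if v.1 then bs v.2.2 else ws v.2.2) <= v.2.1, v.2.1 < fr v.2.2 &
      v.1 ==> ~~ (X v.2.2 && (v.2.1.+1 == fr v.2.2))]%N.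

(** [V j c] is the vector [p_c] of the overview once [j] columns are filled at height [c]. *)
Variables (N : nat) (V : nat -> nat -> 'M[rat]_N) (a : 'rV[rat]_N) (b : 'cV[rat]_N).
Variable g : nat -> 'M[rat]_N.
Hypothesis V0 : forall c, (c < H)%N -> V 0 c = if S0 c then g c else 0.
Hypothesis V_wait : forall j c, (c < H)%N -> (j < n0)%N -> (j < ws c)%N -> V j.+1 c = V j c.
Hypothesis V_step : forall j c, (c < H)%N -> (j < n0)%N -> (ws c <= j)%N ->
  V j.+1 c = (if S0 c && (j == ws c) then om else 1) *: V j c +
    (if c is c'.+1 then if (bs c' <= j)%N then V j.+1 c' else 0 else 0).
Hypothesis V_sqr : forall j c, V j c *m V j c = 0.
Hypothesis V_absent : forall c (fr : nat -> nat) (X : pred nat), (c < H)%N -> S0 c -> ~~ X c ->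
  (forall c', (c' < H)%N -> fr c' = (bs c + (c' < c))%N) ->
  pairing a (dprod H (sel X (fun c' => V (fr c') c'))) b = 0.

(* A height in [S0] that has not been reached yet counts as removed, so that its
   generator takes part in the products from the beginning. *)
Definition admissible (fr : nat -> nat) (X : pred nat) :=
  forall c, (c < H)%N -> (fr c <= bs c)%N -> X c = S0 c.

Definition evolved fr := forall X, admissible fr X ->
  M w (region (partial fr X)) * pairing a (dprod H (sel S0 g)) b =
  pairing a (dprod H (sel X (fun c => V (fr c) c))) b.

Lemma V_waiting j c : (c < H)%N -> (j <= n0)%N -> (j <= bs c)%N ->
  V j c = if S0 c then g c else 0.
Proof.
move=> cH; elim: j => [|j IH] jn jb; first exact: V0.
have jw : (j < ws c)%N := leq_trans jb (leq_subr _ _).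
by rewrite (V_wait cH jn jw) (IH (ltnW jn) (ltnW jb)).
Qed.

Lemma evolved0 : evolved (fun=> 0%N).
Proof.
move=> X adX; have -> : region (partial (fun=> 0%N) X) = fset0.
  apply/fsetP => t; rewrite inE; apply/negP => /imfsetP[v].
  by rewrite !inE /= /partial ltn0 andbF andbF.
rewrite M0 mul1r; congr (pairing a _ b); apply: eq_dprod => c cH.
by rewrite /sel adX // V0 //; case: (S0 c).
Qed.

Lemma eq_evolved fr fr' : (forall c, (c < H)%N -> fr c = fr' c) -> evolved fr -> evolved fr'.
Proof.
move=> frE ev X adX; rewrite (@eq_region _ (partial fr X)) ?ev.
- congr (pairing a _ b); apply: eq_dprod => c cH; by rewrite /sel frE.
- by move=> c cH; rewrite frE //; apply: adX.
- by case=> b' [j c]; rewrite in_box => /andP[_ cH]; rewrite /partial /= frE.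
Qed.

(** With both triangles added, a black one outside [X] forces its lozenge. If it is removed, the new
    white one is matched to its left or to the black one below, and these choices are the two terms
    of [V_step]. *)
Lemma evolved_step fr c : (c < H)%N -> (fr c < n0)%N ->
  (forall c', (c' < H)%N -> fr c' = (fr c + (c' < c))%N) ->
  evolved fr -> evolved (fun c' => (fr c' + (c' == c))%N).
Proof.
move=> cH; move jE : (fr c) => j jn frE ev; set fr' := fun _ => _.
have fr'c : fr' c = j.+1 by rewrite /fr' jE eqxx addn1.
have fr'N c' : c' != c -> fr' c' = fr c' by rewrite /fr' => /negbTE ->; rewrite addn0.
have bsw : (bs c <= ws c)%N by apply: leq_subr.
move=> X adX.
have prodE Y : (forall c', (c' < H)%N -> c' != c -> Y c' = X c') -> Y c = X c ->
    (X c -> V j c = V j.+1 c) ->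
    dprod H (sel Y (fun c0 => V (fr c0) c0)) = dprod H (sel X (fun c0 => V (fr' c0) c0)).
  move=> YX YXc VV; apply: eq_dprod => c' c'H; rewrite /sel.
  have [->|c'c] := eqVneq c' c; last by rewrite YX // fr'N.
  by rewrite YXc; case: ifP => // /VV; rewrite jE fr'c.
have adY : (fr c <= bs c -> X c = S0 c)%N -> admissible fr X.
  move=> hc c' c'H; have [->|c'c] := eqVneq c' c; first exact: hc.
  by rewrite -fr'N //; apply: adX.
(* The row has not started: neither the region nor the vectors change. *)
have [jbs|bsj] := ltnP j (bs c).
  rewrite (@eq_region _ (partial fr X)); last first.
    case=> b' [j' c'] _; rewrite /partial /=.
    have [->|c'c] := eqVneq c' c; last by rewrite fr'N.
    by rewrite fr'c jE; case: b'; apply/and3P/and3P => -[]; lia.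
  rewrite ev; last by apply: adY => _; apply: adX; rewrite ?fr'c.
  rewrite (prodE X) // => _; rewrite V_wait //; lia.
(* Now height [c] is in [S0] and [j = bs c]: only a black triangle appears. *)
have [jws|wsj] := ltnP j (ws c).
  have Sc : S0 c by case Sc: (S0 c) => //; move: bsj jws; rewrite /bs Sc; lia.
  have jbs : j = bs c by move: bsj jws; rewrite /bs Sc; lia.
  case Xc: (X c).
    rewrite (@eq_region _ (partial fr X)); last first.
      case=> b' [j' c'] _; rewrite /partial /=.
      have [->|c'c] := eqVneq c' c; last by rewrite fr'N.
      by rewrite fr'c jE Xc; case: b'; apply/and3P/and3P => -[]; lia.
    rewrite ev; last by apply: adY; rewrite Xc Sc.
    by rewrite (prodE X) // => _; rewrite V_wait.
  (* None of the white neighbours of this black triangle is present yet, so there is no tiling; on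
     the other side [V_absent] gives 0. *)
  rewrite (@M_region _ (true, (j, c)) [::]) ?in_box ?jn ?cH //.
  - rewrite big_nil mul0r -(prodE X) ?Xc // (V_absent (c := c)) ?Xc //.
    by move=> c' c'H; rewrite -jbs frE.
  - by rewrite /partial /= fr'c Xc bsj ltnSn.
  - case=> b' [j' c']; rewrite in_box /partial /adjacent /= => /andP[_ c'H].
    rewrite in_nil => /and3P[h1 h2 _] /andP[]; case: b' h1 => // h1 _.
    case/or3P=> /andP[/eqP ej /eqP ec]; subst j' c'; first by move: h1; lia.
      by move: h2; rewrite fr'c ltnn.
    by move: h2; rewrite fr'N ?frE //; lia.
(* The black triangle stays, and its only neighbour present is the white one added with it. *)
case Xc: (X c); last first.
  rewrite (@M_region _ (true, (j, c)) [:: (false, (j, c))]) ?in_box ?jn ?cH //.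
  - rewrite big_seq1 in_box jn cH /= {1}/partial /= wsj fr'c ltnSn /=.
    rewrite fsetUC w_up // mul1r (@eq_region _ (partial fr X)).
      rewrite ev; first by rewrite (prodE X) ?Xc.
      by apply: adY => jb; case Sc: (S0 c) => //; move: jb; rewrite jE /bs Sc;
        have := ws_gt0 cH Sc; lia.
    case=> b' [j' c'] _; rewrite /remove2 /partial /= -!pair_eqE /= -!pair_eqE /=.
    have [->|c'c] := eqVneq c' c; last by rewrite fr'N // !andbF !andbT.
    by rewrite fr'c jE Xc !andbT /=; case: b' => /=; lia.
  - by rewrite /partial /= fr'c Xc bsj ltnSn.
  - by rewrite /= /adjacent /= !eqxx.
  - case=> b' [j' c']; rewrite in_box /partial /adjacent /= => /andP[_ c'H].
    rewrite inE => /and3P[_ h2 _] /andP[bb'].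
    case/or3P=> /andP[/eqP ej /eqP ec]; subst j' c'; first by case: b' bb'.
      by move: h2; rewrite fr'c ltnn.
    by move: h2; rewrite fr'N ?frE //; lia.
pose wt := if S0 c && (j == ws c) then om else 1 : rat.
pose hop := if c is c0.+1 then (bs c0 <= j)%N && ~~ X c0 else false.
have Xw : partial fr' X (false, (j, c)) by rewrite /partial /= fr'c wsj ltnSn.
have wait0 : (j <= bs c)%N -> S0 c = false.
  by move=> jb; case Sc: (S0 c) => //; move: jb; rewrite /bs Sc; have := ws_gt0 cH Sc; lia.
(* After a match with the black triangle below, [c] is no longer removed at its old frontier, and
   [c.-1] is. *)
pose X' : pred nat := fun c' => if c' == c then false else (c'.+1 == c) || X c'.
pose cs := (if (bs c < j)%N then [:: (true, (j.-1, c))] else [::]) ++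
  (if hop then [:: (true, (j, c.-1))] else [::]).
rewrite (@M_region _ (false, (j, c)) cs) ?in_box ?jn ?cH //; first last.
- case=> b' [j' c']; rewrite in_box /partial /adjacent /= => /andP[_ c'H].
  case/and3P=> h1 h2 h3 /andP[b'T].
  have {b'T} b'T : b' = true by case: b' b'T {h1 h3}.
  subst b'; rewrite /cs mem_cat.
  case/or3P=> /andP[/eqP ej /eqP ec].
  + by subst j' c'; move: h3; rewrite fr'c Xc eqxx.
  + subst c'; rewrite ifT; last by move: h1 => /=; lia.
    by apply/orP; left; rewrite -ej /= inE eqxx.
  + subst j'; rewrite /hop -ec /= h1; move: h3; rewrite fr'N ?frE //; try lia.
    by rewrite -ec ltnSn addn1 eqxx andbT /= => ->; rewrite inE eqxx orbT.
- rewrite /cs all_cat; apply/andP; split; case: ifP => // h /=; rewrite /adjacent /= andbT.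
    by rewrite eqxx andbT; apply/or3P; apply: Or32; lia.
  by move: h; rewrite /hop; case: (c) => //= c0 _; rewrite !eqxx !orbT.
- rewrite /cs; case: ifP => h1; case: ifP => h2 //=; rewrite inE andbT.
  by rewrite xpair_eqE /= xpair_eqE negb_and; apply/orP; left; lia.
have T1 : (if (bs c < j)%N then wt * M w (region (partial fr X)) else 0) *
    pairing a (dprod H (sel S0 g)) b = wt * pairing a (dprod H (sel X (fun c => V (fr c) c))) b.
  case: ifP => jb; first by rewrite -mulrA ev // ; apply: adY; rewrite jE; lia.
  (* Here [j = bs c], so there is no black triangle to the left. Such a height is outside [S0], its
     vector is still the initial 0, and both sides vanish. *)
  have [A [B AB]] := dprod_site (sel X (fun c => V (fr c) c)) cH.
  rewrite mul0r AB // {1}/sel Xc jE V_waiting ?(ltnW jn) ?wait0; try lia.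
  by rewrite mulmx0 mul0mx pairing0 mulr0.
have T2 : (if hop then M w (region (partial fr X')) else 0) *
    pairing a (dprod H (sel S0 g)) b =
    if hop then pairing a (dprod H (sel X' (fun c => V (fr c) c))) b else 0.
  case: ifP => // hp; last by rewrite mul0r.
  rewrite ev // => c' c'H; rewrite /X'; have [->|c'c] := eqVneq c' c.
    by rewrite jE => /wait0.
  case: eqP => [c'1|_]; last by rewrite -fr'N //; apply: adX.
  move: hp; rewrite /hop -c'1 => /andP[bc _]; rewrite frE // -c'1 ltnSn; lia.
rewrite /cs big_cat /= mulrDl.
have -> : \sum_(v <- (if (bs c < j)%N then [:: (true, (j.-1, c))] else [::]))
   (if (v \in box) && partial fr' X v
    then w [fset emb (false, (j, c)); emb v] *
         M w (region (remove2 (partial fr' X) (false, (j, c)) v)) else 0) =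
   if (bs c < j)%N then wt * M w (region (partial fr X)) else 0.
  case: ifP => jb; last by rewrite big_nil.
  rewrite big_seq1 in_box cH ifT; last first.
    by rewrite /partial /= fr'c; lia.
  have j1 : j = j.-1.+1 by lia.
  rewrite {1}j1 w_left -?j1 //; last by lia.
  congr (_ * M _ _); apply: eq_region; case=> b' [j' c'] _.
  rewrite /remove2 /partial /= -!pair_eqE /= -!pair_eqE /=.
  have [->|c'c] := eqVneq c' c; last by rewrite fr'N // !andbF !andbT.
  by rewrite fr'c jE Xc !andbT /=; case: b' => /=; lia.
have -> : \sum_(v <- (if hop then [:: (true, (j, c.-1))] else [::]))
   (if (v \in box) && partial fr' X v
    then w [fset emb (false, (j, c)); emb v] *
         M w (region (remove2 (partial fr' X) (false, (j, c)) v)) else 0) =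
   if hop then M w (region (partial fr X')) else 0.
  case: ifP => hp; last by rewrite big_nil.
  have {hp} [c0 [cE bc Xc0]] : exists c0, [/\ c = c0.+1, (bs c0 <= j)%N & ~~ X c0].
    by move: hp; rewrite /hop; case: (c) => // c0 /andP[bc Xc0]; exists c0.
  have c0H : (c0 < H)%N by lia.
  have c0c : (c0 == c) = false by lia.
  have frc0 : fr' c0 = j.+1 by rewrite fr'N ?c0c // frE // cE ltnSn addn1.
  have -> : c.-1 = c0 by rewrite cE.
  rewrite big_seq1 in_box jn c0H ifT; last first.
    by rewrite /partial /= frc0 (negbTE Xc0) bc ltnSn.
  rewrite {1}cE w_hop -?cE // mul1r; congr (M _ _); apply: eq_region; case=> b' [j' c'] _.
  rewrite /remove2 /partial /X' /= -!pair_eqE /= -!pair_eqE /=.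
  have [->|c'c] := eqVneq c' c.
    rewrite fr'c jE Xc (eq_sym c c0) c0c !andbT !andbF /=.
    by case: b' => /=; lia.
  have [->|c'0] := eqVneq c' c0.
    by rewrite frc0 frE // cE ltnSn eqxx (negbTE Xc0) /= !andbF; case: b' => /=; lia.
  by rewrite fr'N // !andbF !andbT /= cE eqSS (negbTE c'0) /=.
rewrite T1 T2; move: T1 T2 => _ _.
have [cE|[c0 cE]] : c = 0%N \/ exists c0, c = c0.+1 by case: (c) => [|c0]; [left|right; exists c0].
  have [A [B AB]] := dprod_site (sel X (fun c => V (fr c) c)) cH.
  rewrite (AB (sel X (fun c => V (fr c) c))) // (AB (sel X (fun c => V (fr' c) c))); last first.
    by move=> c' c'H c'c; rewrite /sel fr'N.
  rewrite /sel Xc fr'c jE V_step // -/wt cE addr0 /hop cE addr0.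
  by rewrite -scalemxAr -scalemxAl pairingZ.
have c1H : (c0.+1 < H)%N by rewrite -cE.
have c0c : c0 != c by lia.
have frc0 : fr c0 = j.+1 by rewrite frE; [rewrite cE ltnSn addn1|lia].
have [A [B AB]] := dprod_site2 (sel X (fun c => V (fr c) c)) c1H.
rewrite (AB (sel X (fun c => V (fr c) c))) // (AB (sel X (fun c => V (fr' c) c))); last first.
  by move=> c' c'H c'0 c'1; rewrite /sel fr'N // cE.
rewrite (AB (sel X' (fun c => V (fr c) c))); last first.
  by move=> c' c'H c'0 c'1; rewrite /sel /X' cE eqSS (negbTE c'0) (negbTE c'1).
rewrite -cE /sel Xc fr'c jE fr'N // frc0 (V_step cH jn wsj) -/wt.
have -> : (if c is c'.+1 then if (bs c' <= j)%N then V j.+1 c' else 0 else 0) =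
  (if (bs c0 <= j)%N then V j.+1 c0 else 0) :> 'M_N by rewrite cE.
have -> : hop = (bs c0 <= j)%N && ~~ X c0 by rewrite /hop cE.
have [-> ->] : X' c = false /\ X' c0 = true by rewrite /X' eqxx (negbTE c0c) -cE eqxx.
rewrite mulmxDl mulmxDr mulmxDl pairingD -scalemxAl -scalemxAr -scalemxAl pairingZ; congr (_ + _).
case: (bs c0 <= j)%N; last by rewrite mul0mx mulmx0 mul0mx pairing0.
(* If [c0] is in [X], the triangle below is already removed and a vector gets squared to 0.
   Otherwise the vector moves to the free neighbouring place, without sign. *)
case: (X c0) => /=; last by rewrite mul1mx mulmx1.
by rewrite V_sqr mulmx0 mul0mx pairing0.
Qed.

Lemma evolved_columns j : (j <= n0)%N -> evolved (fun=> j).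
Proof.
elim: j => [|j IH] jn; first exact: evolved0.
suff /(_ H (leqnn H)) ev c : (c <= H)%N -> evolved (fun c' => (j + (c' < c))%N).
  by apply: eq_evolved ev => c cH; rewrite cH addn1.
elim: c => [|c IHc] cH.
  by apply: eq_evolved (IH (ltnW jn)) => c _; rewrite ltn0 addn0.
have := @evolved_step (fun c' => (j + (c' < c))%N) c cH; rewrite ltnn addn0 => step.
apply: eq_evolved (step jn (fun _ _ => erefl) (IHc (ltnW cH))) => c' _.
by rewrite -addnA; congr (_ + _)%N; case: ltngtP; lia.
Qed.

End HalfRegion.

(** * Half regions represent minors *)

Section Represent.
Variables (emb : vertex -> triangle) (w : {fset triangle} -> rat) (n0 H : nat).
Hypothesis emb_inj : injective emb.
Hypothesis emb_adj : forall v u, share_edge (emb v) (emb u) = adjacent v u.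
Variables (ws : nat -> nat) (S0 : pred nat) (om sc : rat).
Local Notation bs := (bs ws S0).
Hypothesis ws_gt0 : forall c, (c < H)%N -> S0 c -> (0 < ws c)%N.
Hypothesis ws_le : forall c, (c < H)%N -> (ws c <= n0)%N.
Hypothesis w_up : forall j c, (j < n0)%N -> (c < H)%N -> (ws c <= j)%N ->
  w [fset emb (false, (j, c)); emb (true, (j, c))] = 1.
Hypothesis w_hop : forall j c, (j < n0)%N -> (c.+1 < H)%N -> (ws c.+1 <= j)%N -> (bs c <= j)%N ->
  w [fset emb (false, (j, c.+1)); emb (true, (j, c))] = 1.
Hypothesis w_left : forall j c, (j.+1 < n0)%N -> (c < H)%N -> (ws c <= j.+1)%N -> (bs c <= j)%N ->
  w [fset emb (false, (j.+1, c)); emb (true, (j, c))] =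
    (if S0 c && (j.+1 == ws c) then om else 1).
(** [cf d j c] is the coordinate of [V j c] along the generator [g d]. *)
Variable cf : nat -> nat -> nat -> rat.
Hypothesis cf0 : forall d c, (d < H)%N -> (c < H)%N -> S0 d -> cf d 0 c = sc *+ (c == d).
Hypothesis cf_wait : forall d j c, (d < H)%N -> S0 d -> (c < H)%N -> (j < n0)%N ->
  (j < ws c)%N -> cf d j.+1 c = cf d j c.
Hypothesis cf_step : forall d j c, (d < H)%N -> S0 d -> (c < H)%N -> (j < n0)%N ->
  (ws c <= j)%N -> cf d j.+1 c = (if S0 c && (j == ws c) then om else 1) * cf d j c +
    (if c is c'.+1 then if (bs c' <= j)%N then cf d j.+1 c' else 0 else 0).
Hypothesis cf_absent : forall c c', (c < H)%N -> S0 c -> (c' < H)%N -> c' != c ->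
  cf c (bs c + (c' < c))%N c' = 0.

Lemma dprod_selZ N n (g : nat -> 'M[rat]_N) k :
  dprod n (sel S0 (fun c => k *: g c)) = k ^+ count S0 (iota 0 n) *: dprod n (sel S0 g).
Proof.
elim: n => [|n IH]; first by rewrite expr0 scale1r.
rewrite [LHS]/= IH -addn1 iotaD count_cat add0n [in RHS]addn1 /= addn0 {1 3}/sel.
case: ifP => _; last by rewrite addn0 !mul1mx.
by rewrite addn1 exprS -scalemxAl -!scalemxAr scalerA.
Qed.

(** A height with [n0 <= bs c] has no black triangle to remove. [partial] would ignore its presence
    in [X], so the value 0 is imposed. *)
Definition count_half (X : seq nat) : rat :=
  if all (fun c => bs c < n0)%N X then
    sc ^+ count S0 (iota 0 H) * M w (region emb n0 H (partial ws S0 (fun=> n0) (mem X)))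
  else 0.

Lemma represents_half : represents H S0 count_half (fun d c => cf d n0 c).
Proof.
move=> N g a b [gg gB] X XS; rewrite /count_half.
pose V j c : 'M[rat]_N := vec H S0 g (fun d c => cf d j c) c.
have Vsqr j c : V j c *m V j c = 0.
  by apply/acomm_sqr/acomm_vec2.
have V0' c : (c < H)%N -> V 0%N c = if S0 c then sc *: g c else 0.
  move=> cH; rewrite /V /vec.
  rewrite (eq_bigr (fun d : 'I_H => if (d == Ordinal cH) then sc *: g d else 0)).
    rewrite -big_mkcondr big_mkcond (bigD1 (Ordinal cH)) //= eqxx andbT big1 ?addr0 //.
    by move=> d /negbTE ->; rewrite andbF.
  move=> d Sd; rewrite cf0 // (eq_sym c) -(inj_eq val_inj) /=.
  by case: eqP; rewrite ?mulr1n // mulr0n scale0r.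
have Vw j c : (c < H)%N -> (j < n0)%N -> (j < ws c)%N -> V j.+1 c = V j c.
  by move=> cH jn jw; apply: eq_bigr => d Sd; rewrite cf_wait.
have Vs j c : (c < H)%N -> (j < n0)%N -> (ws c <= j)%N ->
    V j.+1 c = (if S0 c && (j == ws c) then om else 1) *: V j c +
    (if c is c'.+1 then if (bs c' <= j)%N then V j.+1 c' else 0 else 0).
  move=> cH jn jw; rewrite /V /vec scaler_sumr.
  have -> : (if c is c'.+1 then if (bs c' <= j)%N then
      \sum_(d < H | S0 d) cf d j.+1 c' *: g d else 0 else 0) =
    \sum_(d < H | S0 d) (if c is c'.+1 then if (bs c' <= j)%N then cf d j.+1 c' else 0 else 0) *: g d.
    case: (c) => [|c']; first by rewrite big1 // => d _; rewrite scale0r.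
    by case: ifP => // _; rewrite big1 // => d _; rewrite scale0r.
  rewrite -big_split /=; apply: eq_bigr => d Sd.
  by rewrite (cf_step (ltn_ord d) Sd cH jn jw) scalerDl scalerA.
(* By [cf_absent], at this moment [g c] occurs in no vector other than that of height [c], so the
   annihilator of [g c] passes the whole product. *)
have Va c (fr : nat -> nat) (Y : pred nat) : (c < H)%N -> S0 c -> ~~ Y c ->
    (forall c', (c' < H)%N -> fr c' = (bs c + (c' < c))%N) ->
    pairing a (dprod H (sel Y (fun c' => V (fr c') c'))) b = 0.
  move=> cH Sc Yc frE; have [B [Bg aB Bb Bd]] := gB c cH Sc.
  apply: (pairing_absent aB Bb Bg); apply: gcomm_dprod => c' c'H; rewrite /sel.
  case: ifP => [Yc'|_]; last exact: gcomm1.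
  have c'c : c' != c by apply: contraTneq Yc' => ->.
  apply: gcomm_acomm; rewrite /V /vec big_mkcond acomm_sumr big1 // => d _.
  case: ifP => Sd; last by rewrite /acomm mulmx0 mul0mx addr0.
  have [->|dc] := eqVneq (d : nat) c; last by rewrite acommZr Bd // scaler0.
  by rewrite frE // cf_absent // scale0r /acomm mulmx0 mul0mx addr0.
have ev := evolved_columns emb_inj emb_adj ws_gt0 w_up w_hop w_left V0' Vw Vs Vsqr Va (leqnn n0).
case: ifP => [/allP Xb|/allPn[c cX cb]].
  rewrite -[LHS]mulrAC -ev; last first.
    move=> c cH; case Sc : (S0 c) => nb; last first.
      by apply/negP => /Xb; rewrite ltnNge nb.
    by move: nb; rewrite /bs Sc; have := ws_le cH; have := ws_gt0 cH Sc; lia.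
  by rewrite dprod_selZ pairingZ [RHS]mulrC mulrAC.
have cH := subseqs_lt XS cX.
have Sc : S0 c = false.
  by apply/negP => Sc; move: cb; rewrite /bs Sc; have := ws_le cH; have := ws_gt0 cH Sc; lia.
have [A [B AB]] := dprod_site (sel (mem X) (vec H S0 g (fun d c => cf d n0 c))) cH.
rewrite mul0r AB // {1}/sel /= cX.
(* Height [c] lies outside [S0] and never starts, so its vector keeps the initial value 0. *)
have -> : vec H S0 g (fun d c => cf d n0 c) c = 0.
  by have := V_waiting V0' Vw cH (leqnn n0); rewrite leqNgt cb Sc => /(_ isT).
by rewrite mulmx0 mul0mx pairing0.
Qed.

End Represent.

(* The coefficients of [(1 - z)^(-y)] and, for [y > 1], of
   [(1 + z) (1 - z)^(-y)]; the value at [y = 1] is [2] also for [r = 0],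
   because the weight [1/2] only acts on the step from [y = 1] to [y = 2]. *)
Definition acoef (y r : nat) : rat := 'C((y + r).-1, r)%:R.
Definition bcoef (y r : nat) : rat :=
  match y with 0 => 2 *+ (r == 0%N) | 1 => 2 | y'.+1 => 2 * acoef y r - acoef y' r end.

Lemma acoefr0 y : acoef y 0 = 1. Proof. by rewrite /acoef bin0. Qed.
Lemma acoef0 r : acoef 0 r.+1 = 0. Proof. by rewrite /acoef /= bin_small. Qed.
Lemma acoef1 r : acoef 1 r = 1. Proof. by rewrite /acoef add1n /= binn. Qed.
Lemma acoefS y r : acoef y.+1 r.+1 = acoef y r.+1 + acoef y.+1 r.
Proof. by rewrite /acoef !addnS !addSn /= binS natrD. Qed.
Lemma bcoefr0 y : bcoef y.+2 0 = 1. Proof. by rewrite /bcoef !acoefr0; ring. Qed.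
Lemma bcoefS y r : bcoef y.+1 r.+1 = bcoef y r.+1 + bcoef y.+1 r.
Proof.
case: y => [|[|y]] /=; first by rewrite mulr0n add0r.
  by rewrite acoefS !acoef1; ring.
by rewrite !acoefS; ring.
Qed.

(** * Coordinates of the growing vectors *)

Section Coefficients.
Variables (n0 H : nat) (ws : nat -> nat) (S0 : pred nat).
Local Notation bs := (bs ws S0).
Hypothesis ws_gt0 : forall c, (c < H)%N -> S0 c -> (0 < ws c)%N.
Hypothesis ws_le : forall c, (c < H)%N -> (ws c <= n0)%N.
Hypothesis ws_mono : forall d c, (d < c)%N -> (c < H)%N -> S0 d -> (ws c <= bs d)%N.

(** The coefficient of [z^(c - d)] in the series reached [j - bs d] columns after row [d] starts;
    truncated subtraction keeps the initial series [F 0] until then. *)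
Definition shifted (F : nat -> nat -> rat) d j c : rat :=
  if (c < d)%N then 0 else F (j - bs d)%N (c - d)%N.

Section Steps.
Variables (F : nat -> nat -> rat) (sc om : rat).
(** [FS] is division by [1 - z]; only constant terms are special. They stay at [sc] while the white
    triangles are awaited, are multiplied by [om] from 1 to 2, and are constant afterwards. *)
Hypothesis F0 : forall r, F 0 r = sc *+ (r == 0%N).
Hypothesis F1 : F 1 0 = sc.
Hypothesis F2 : F 2 0 = om * F 1 0.
Hypothesis F3 : forall y, F y.+3 0 = F y.+2 0.
Hypothesis FS : forall y r, F y.+1 r.+1 = F y r.+1 + F y.+1 r.

Lemma shifted0 d c : shifted F d 0 c = sc *+ (c == d).
Proof.
rewrite /shifted sub0n F0; have [cd|dc] := ltnP c d; first by rewrite ltn_eqF.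
by rewrite subn_eq0 eqn_leq dc andbT.
Qed.

Lemma shifted_wait d j c : (d < H)%N -> S0 d -> (c < H)%N -> (j < ws c)%N ->
  shifted F d j.+1 c = shifted F d j c.
Proof.
move=> dH Sd cH jw; rewrite /shifted; have [//|dc] := ltnP c d.
case: (ltngtP d c) dc => // [dc|dc] _.
  have wb := ws_mono dc cH Sd.
  by have [-> ->] : (j.+1 - bs d = 0)%N /\ (j - bs d = 0)%N by lia.
subst c; rewrite subnn; have -> : (j - bs d = 0)%N by move: jw; rewrite /bs Sd; lia.
have : (j.+1 - bs d <= 1)%N by move: jw; rewrite /bs Sd; lia.
by case: (j.+1 - bs d)%N => [|[|]] // _; rewrite F1 F0.
Qed.

Lemma shifted_step d j c : (d < H)%N -> S0 d -> (c < H)%N -> (ws c <= j)%N ->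
  shifted F d j.+1 c = (if S0 c && (j == ws c) then om else 1) * shifted F d j c +
    (if c is c'.+1 then if (bs c' <= j)%N then shifted F d j.+1 c' else 0 else 0).
Proof.
move=> dH Sd cH wj; have [cd|dc] := ltnP c d.
  have s0 j' c' : (c' <= c)%N -> shifted F d j' c' = 0.
    by move=> c'c; rewrite /shifted ifT //; lia.
  rewrite !s0 // mulr0 add0r; case: (c) s0 => // c' s0.
  by case: ifP => // _; rewrite s0.
case: (ltngtP d c) dc => // [dc|dc] _; last first.
  subst c; have -> : (if d is c'.+1 then if (bs c' <= j)%N then shifted F d j.+1 c' else 0 else 0) = 0.
    by case: (d) => // c'; case: ifP => // _; rewrite /shifted ltnSn.
  rewrite addr0 /shifted ltnn subnn Sd /=.
  have w0 := ws_gt0 dH Sd; have bE : bs d = (ws d).-1 by rewrite /bs Sd subn1.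
  have [jw|jw] := eqVneq j (ws d).
    have -> : (j.+1 - bs d = 2)%N by lia.
    by have -> : (j - bs d = 1)%N by lia.
  have [y yE] : exists y, (j - bs d = y.+2)%N by exists (j - bs d - 2)%N; lia.
  have -> : (j.+1 - bs d = y.+3)%N by lia.
  by rewrite yE mul1r F3.
have wb := ws_mono dc cH Sd; case cE : c dc => [//|c'] dc.
have [r rE] : exists r, (c'.+1 - d = r.+1)%N by exists (c' - d)%N; lia.
have rE' : (c' - d = r)%N by lia.
have [n1 n2] : (c'.+1 < d)%N = false /\ (c' < d)%N = false by lia.
rewrite /shifted n1 n2 rE rE'.
have [jb|bj] := ltnP j (bs d).
  have -> : (j.+1 - bs d = 0)%N by lia.
  have -> : (j - bs d = 0)%N by lia.
  rewrite !F0 /= !mulr0n mulr0 add0r.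
  case: (r) rE' => [|r'] rE'; last by rewrite mulr0n; case: ifP.
  have -> : c' = d by lia.
  by rewrite leqNgt jb.
have -> : (j.+1 - bs d = (j - bs d).+1)%N by lia.
have -> : (bs c' <= j)%N.
  have [<- //|dc'] := eqVneq d c'.
  have wc' : (ws c' <= bs d)%N by apply: ws_mono => //; lia.
  by apply: leq_trans bj; apply: leq_trans wc'; apply: leq_subr.
rewrite FS; case: ifP => [/andP[Sc /eqP jw]|_]; last by rewrite mul1r.
(* The weight [om] of row [c] acts at [j = ws c <= bs d], when row [d] has no coefficient at a
   positive exponent yet: it multiplies 0. *)
have -> : (j - bs d = 0)%N by move: wb; rewrite cE; lia.
by rewrite F0 mulr0n mulr0.
Qed.

Lemma shifted_absent c c' : c' != c -> shifted F c (bs c + (c' < c))%N c' = 0.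
Proof.
rewrite /shifted; case: ltngtP => // cc' _; rewrite addn0 subnn F0.
by case: eqP => [|_]; [lia | rewrite mulr0n].
Qed.

End Steps.

(** Partial sums are division of the series by [1 - z]. *)
Lemma acoef_sum y r : \sum_(s < r.+1) acoef y s = acoef y.+1 r.
Proof.
elim: r => [|r IH]; first by rewrite big_ord_recr big_ord0 /= add0r !acoefr0.
by rewrite big_ord_recr /= IH acoefS addrC.
Qed.

(** With [y = n0 - bs d], positive here, this is [(1 + z) (1 - z)^(-y-1) = (1 + 2 z + 2 z^2 + ...)
    (1 - z)^(-y)]; the exponent [y + 1] is due to the extra column. *)
Lemma shifted_cumul d c : (d < H)%N -> (c < H)%N -> S0 d ->
  shifted bcoef d n0.+1 c = shifted acoef d n0 c + 2 * \sum_(i < c) shifted acoef d n0 i.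
Proof.
move=> dH cH Sd; rewrite /shifted.
have w0 := ws_gt0 dH Sd; have wn := ws_le dH.
have [y yE] : exists y, (n0 - bs d = y.+1)%N.
  by exists (n0 - bs d).-1; rewrite /bs Sd; lia.
have -> : (n0.+1 - bs d = y.+2)%N by lia.
rewrite yE; have [cd|dc] := ltnP c d.
  rewrite big1 ?mulr0 ?addr0 // => i _; rewrite ifT //; exact: ltn_trans cd.
move rE : (c - d)%N => r; have {rE} -> : c = (d + r)%N by lia.
have -> : \sum_(i < (d + r)%N) (if (i < d)%N then 0 else acoef y.+1 (i - d)) = \sum_(s < r) acoef y.+1 s.
  rewrite big_split_ord /= big1 ?add0r => [|i _]; last by rewrite ltn_ord.
  by apply: eq_bigr => i _; rewrite ifF ?addKn //; lia.
case: r => [|r]; first by rewrite big_ord0 mulr0 addr0 bcoefr0 acoefr0.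
by rewrite acoef_sum /= [acoef y.+2 r.+1]acoefS; ring.
Qed.

End Coefficients.

(** * The regions of the theorem *)

Section Geometry.
Variables (m k : nat) (lam : k.-tuple nat) (I : {set 'I_k}).
Hypothesis hlam : strict_partition lam.

Definition width : nat := head 0%N lam.
Local Notation n0 := width.
Definition height : nat := (m + k)%N.
Local Notation H := height.
Definition row_part (c : nat) : nat := nth 0%N lam (k - c.+1).
(** The start is the same for both halves: columns are counted from the outer end towards the axis,
    and a row of part [p] has its first white triangle at a = -p + 1 on the left and a = p - 1 on
    the right. *)
Definition white_start (c : nat) : nat := if (c < k)%N then (n0 - row_part c).+1 else 0%N.
Definition active (c : nat) : bool := [exists i : 'I_k, (i \notin I) && (i + c.+1 == k)%N].
Local Notation ws := white_start.
Local Notation S0 := active.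
Local Notation bs := (bs ws S0).

Lemma row_part_lt c d : (d < c)%N -> (c < k)%N -> (row_part d < row_part c)%N.
Proof.
move=> dc ck; have /andP[srt _] := hlam.
have tr : transitive gtn by move=> x y z /= xy yz; apply: ltn_trans xy.
have := sorted_ltn_nth tr 0%N srt => /(_ (k - c.+1)%N (k - d.+1)%N).
by rewrite !inE size_tuple; apply; lia.
Qed.

Lemma row_part_gt0 c : (c < k)%N -> (0 < row_part c)%N.
Proof.
move=> ck; have /andP[_ /allP] := hlam; apply; apply: mem_nth.
by rewrite size_tuple; lia.
Qed.

Lemma row_part_le c : (c < k)%N -> (row_part c <= n0)%N.
Proof.
move=> ck; have -> : n0 = row_part k.-1.
  by rewrite /n0 /row_part prednK ?subnn ?nth0 //; lia.
have [->//|ck'] := eqVneq c k.-1.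
by apply/ltnW/row_part_lt; lia.
Qed.

Lemma active_lt c : S0 c -> (c < k)%N.
Proof. by case/existsP => i /andP[_ /eqP <-]; have := ltn_ord i; lia. Qed.

Lemma bsE c : (c < k)%N -> bs c = if S0 c then (n0 - row_part c)%N else (n0 - row_part c).+1.
Proof. by move=> ck; rewrite /bs /ws ck; case: (S0 c); rewrite ?subn1 ?subn0. Qed.

Lemma bs_top c : (k <= c)%N -> bs c = 0%N.
Proof. by move=> kc; rewrite /bs /ws ltnNge kc. Qed.

Lemma ws_top c : (k <= c)%N -> ws c = 0%N.
Proof. by move=> kc; rewrite /ws ltnNge kc. Qed.

Lemma ws_gt0 c : (c < H)%N -> S0 c -> (0 < ws c)%N.
Proof. by move=> _ /active_lt ck; rewrite /ws ck. Qed.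

Lemma ws_le c : (c < H)%N -> (ws c <= n0)%N.
Proof.
rewrite /ws; case: ifP => // ck _.
by have := row_part_gt0 ck; have := row_part_le ck; lia.
Qed.

(** Strictness of [lam] gives this: a row above row [d] is strictly longer, hence starts early
    enough even for its white triangles. *)
Lemma ws_mono d c : (d < c)%N -> (c < H)%N -> S0 d -> (ws c <= bs d)%N.
Proof.
move=> dc _ Sd; rewrite bsE ?(active_lt Sd) // Sd /ws; case: ifP => // ck.
by have := row_part_lt dc ck; have := row_part_le ck; lia.
Qed.

Definition embA (v : vertex) : triangle :=
  let: (b, (j, c)) := v in
  if b then Ltri (j%:Z - n0%:Z) c%:Z else Rtri (j%:Z - n0%:Z) c%:Z.

(* The reflection in the axis maps R(a, c - a) to L(- a - 1, c). *)
Definition embB (v : vertex) : triangle :=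
  let: (b, (j, c)) := v in let a := n0%:Z - j%:Z in
  if b then Rtri a (c%:Z - a) else Ltri a (c%:Z - a - 1).

Lemma embA_inj : injective embA.
Proof.
move=> [[] [j c]] [[] [j' c']] //= [] ejc ec;
by congr (_, (_, _)); lia.
Qed.

Lemma embB_inj : injective embB.
Proof.
move=> [[] [j c]] [[] [j' c']] //= [] ejc ec;
by congr (_, (_, _)); lia.
Qed.

Lemma embA_adj v u : share_edge (embA v) (embA u) = adjacent v u.
Proof.
case: v u => [[] [j c]] [[] [j' c']] /=; [by rewrite share_edge_LL|
  rewrite share_edgeC share_edge_RL|rewrite share_edge_RL|by rewrite share_edge_RR];
  rewrite /adjacent /=; lia.
Qed.

Lemma embB_adj v u : share_edge (embB v) (embB u) = adjacent v u.
Proof.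
case: v u => [[] [j c]] [[] [j' c']] /=; [by rewrite share_edge_RR|
  rewrite share_edge_RL|rewrite share_edgeC share_edge_RL|by rewrite share_edge_LL];
  rewrite /adjacent /=; lia.
Qed.

Definition half_A X := region embA n0 H (partial ws S0 (fun=> n0) X).
(** The extra column holds the black triangles R(0,c). Removing the last black triangles at the
    heights in [X] is thus what crossing lozenges do to either half. *)
Definition half_B X := region embB n0.+1 H (partial ws S0 (fun=> n0.+1) X).

Lemma row_index (c : nat) : (c < k)%N -> exists i : 'I_k,
  [/\ level i = c%:Z, part lam i = (row_part c)%:Z & S0 c = (i \notin I)].
Proof.
move=> ck; have ik : (k - c.+1 < k)%N by lia.
exists (Ordinal ik); split; first by rewrite /level /=; lia.
  by rewrite /part /row_part (tnth_nth 0%N).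
apply/existsP/idP => [[i /andP[iI /eqP ic]]|iI].
  by rewrite (_ : Ordinal ik = i) //; apply: val_inj => /=; lia.
by exists (Ordinal ik); rewrite iI /=; lia.
Qed.

Lemma index_row (i : 'I_k) : exists c : nat,
  [/\ (c < k)%N, level i = c%:Z, part lam i = (row_part c)%:Z & S0 c = (i \notin I)].
Proof.
have ik := ltn_ord i; exists (k - i.+1)%N; split; first by lia.
- by rewrite /level; lia.
- by rewrite /part /row_part (tnth_nth 0%N); congr (Posz (nth _ _ _)); lia.
- apply/existsP/idP => [[i' /andP[iI /eqP ic]]|iI].
    by rewrite (_ : i = i') //; apply: val_inj => /=; lia.
  by exists i; rewrite iI /=; lia.
Qed.

Lemma in_half_A X b (a c : int) :
  ((if b then Ltri a c else Rtri a c) \in half_A X) =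
  [&& - n0%:Z <= a, a < 0, 0 <= c, c < H%:Z &
      partial ws S0 (fun=> n0) X (b, (absz (a + n0%:Z), absz c))].
Proof.
apply/idP/idP => [/imfsetP[[b' [j c']]]|/and5P[a1 a2 c1 c2 P]].
  rewrite !inE in_box /= => /andP[/andP[jn cH] P].
  case: b; case: b' P => // P [-> ->]; rewrite subrK /= P andbT; lia.
have -> : (if b then Ltri a c else Rtri a c) = embA (b, (absz (a + n0%:Z), absz c)).
  by rewrite /embA; case: b P => P; [congr Ltri | congr Rtri]; lia.
by rewrite (in_region _ _ embA_inj) in_box P andbT; lia.
Qed.

Lemma regionA_half : regionA m lam I = half_A pred0.
Proof.
apply/fsetP => t; apply/idP/idP.
  rewrite /regionA !in_fsetU => /orP[/orP[]|].
  - case/imfset2P => c /= + [a] /=; rewrite !mem_zrange => hc ha ->.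
    rewrite (in_half_A pred0 false) /partial /= ws_top; last by lia.
    by rewrite /lam1 -/n0 in ha; rewrite /H; lia.
  - case/imfset2P => c /= + [a] /=; rewrite !mem_zrange => hc ha ->.
    rewrite (in_half_A pred0 true) /partial /= bs_top; last by lia.
    by rewrite /lam1 -/n0 in ha; rewrite /H; lia.
  - case/bigfcupP => i _; have [c [ck -> -> Sc]] := index_row i.
    have [lc0 lcn] := (row_part_gt0 ck, row_part_le ck).
    rewrite in_fsetU => /orP[]/imfsetP[a] /=.
      rewrite mem_zrange => ha ->.
      by rewrite (in_half_A pred0 false) /partial /= /ws ck /H; lia.
    rewrite !inE /= mem_zrange => /andP[ha hI] ->.
    by rewrite (in_half_A pred0 true) /partial /= bsE // /H Sc; case: (i \in I) hI => /=; lia.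
case: t => a c.
  rewrite (in_half_A pred0 false) /partial /= => /and5P[a1 a2 c1 c2 /and3P[wa _ _]].
  rewrite /regionA !in_fsetU; have [kc|ck] := leP k%:Z c.
    apply/orP; left; apply/orP; left; apply/imfset2P; exists c.
      by rewrite /= mem_zrange; rewrite /H in c2; lia.
    by exists a; rewrite //= mem_zrange /lam1 -/n0; lia.
  apply/orP; right; have ck' : (absz c < k)%N by lia.
  have [i [li pi Si]] := row_index ck'.
  apply/bigfcupP; exists i; first by rewrite mem_enum.
  rewrite in_fsetU; apply/orP; left; apply/imfsetP; exists a.
    rewrite /= mem_zrange pi; move: wa; rewrite /ws ck'.
    by have := row_part_le ck'; lia.
  by rewrite li; congr Rtri; lia.
rewrite (in_half_A pred0 true) /partial /= => /and5P[a1 a2 c1 c2 /and3P[wa _ _]].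
rewrite /regionA !in_fsetU; have [kc|ck] := leP k%:Z c.
  apply/orP; left; apply/orP; right; apply/imfset2P; exists c.
    by rewrite /= mem_zrange; rewrite /H in c2; lia.
  by exists a; rewrite //= mem_zrange /lam1 -/n0; lia.
apply/orP; right; have ck' : (absz c < k)%N by lia.
have [i [li pi Si]] := row_index ck'.
apply/bigfcupP; exists i; first by rewrite mem_enum.
rewrite in_fsetU; apply/orP; right; apply/imfsetP; exists a; last by rewrite li; congr Ltri; lia.
rewrite !inE /= mem_zrange pi; move: wa; rewrite bsE // Si.
have := row_part_le ck'; case: (i \in I) => /=; lia.
Qed.

Lemma in_half_B X b (a c : int) :
  ((if b then Rtri a (c - a) else Ltri a (c - a - 1)) \in half_B X) =
  [&& 0 <= a, a <= n0%:Z, 0 <= c, c < H%:Z &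
      partial ws S0 (fun=> n0.+1) X (b, (absz (n0%:Z - a), absz c))].
Proof.
apply/idP/idP => [/imfsetP[[b' [j c']]]|/and5P[a1 a2 c1 c2 P]].
  rewrite !inE in_box /= => /andP[/andP[jn cH] P].
  case: b; case: b' P => // P [ea ec];
    have -> : absz (n0%:Z - a) = j by lia.
  - have -> : absz c = c' by lia.
    by rewrite P; lia.
  - have -> : absz c = c' by lia.
    by rewrite P; lia.
have -> : (if b then Rtri a (c - a) else Ltri a (c - a - 1)) = embB (b, (absz (n0%:Z - a), absz c)).
  by rewrite /embB; case: b P => P; [congr Rtri | congr Ltri]; lia.
by rewrite (in_region _ _ embB_inj) in_box P andbT; lia.
Qed.

Lemma regionAtilde_half : regionAtilde m lam I = regionA m lam I `|` half_B pred0.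
Proof.
have RB (a c : int) : Rtri a (c - a) \in half_B pred0 =
  [&& 0 <= a, a <= n0%:Z, 0 <= c, c < H%:Z & (bs (absz c) <= absz (n0%:Z - a))%N].
  rewrite (in_half_B pred0 true) /partial /=.
  by apply/idP/idP; lia.
have LB (a c : int) : Ltri a (c - a - 1) \in half_B pred0 =
  [&& 0 <= a, a <= n0%:Z, 0 <= c, c < H%:Z & (ws (absz c) <= absz (n0%:Z - a))%N].
  rewrite (in_half_B pred0 false) /partial /=.
  by apply/idP/idP; lia.
rewrite /regionAtilde -2!(fsetUA (regionA m lam I)); apply: (f_equal (fsetU _)).
apply/fsetP => t; apply/idP/idP.
  rewrite !in_fsetU => /orP[/orP[]|].
  - case/imfset2P => c /= + [a] /=; rewrite !mem_zrange => hc ha ->.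
    rewrite RB bs_top; last by lia.
    by rewrite /lam1 -/n0 in ha; rewrite /H; lia.
  - case/imfset2P => c /= + [a] /=; rewrite !mem_zrange => hc ha ->.
    rewrite LB ws_top; last by lia.
    by rewrite /lam1 -/n0 in ha; rewrite /H; lia.
  - case/bigfcupP => i _; have [c [ck -> -> Sc]] := index_row i.
    have [lc0 lcn] := (row_part_gt0 ck, row_part_le ck).
    rewrite !in_fsetU => /orP[/orP[]|].
    + case/imfsetP => a /=; rewrite mem_zrange => ha ->.
      by rewrite RB /= bsE // /H; case: ifP => _; lia.
    + case/imfsetP => a /=; rewrite mem_zrange => ha ->.
      by rewrite LB /= /ws ck /H; lia.
    + case: ifP => [_|iI]; first by rewrite inE.
      by rewrite inE => /eqP ->; rewrite RB /= bsE // Sc iI /H /=; lia.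
case: t => a c.
  have -> : Rtri a c = Rtri a ((c + a) - a) by rewrite addrK.
  rewrite RB; move: (c + a) => {}c /and5P[a1 a2 c1 c2 wa].
  rewrite !in_fsetU; have [kc|ck] := leP k%:Z c.
    apply/orP; left; apply/orP; left; apply/imfset2P; exists c.
      by rewrite /= mem_zrange; rewrite /H in c2; lia.
    by exists a; rewrite //= mem_zrange /lam1 -/n0; lia.
  apply/orP; right; have ck' : (absz c < k)%N by lia.
  have [i [li pi Si]] := row_index ck'; have lcn := row_part_le ck'.
  have cE : (absz c)%:Z = c by lia.
  apply/bigfcupP; exists i; first by rewrite mem_enum.
  rewrite !in_fsetU li pi cE; move: wa; rewrite bsE // Si => wa.
  have [al|al] := ltP a (row_part (absz c))%:Z.
    apply/orP; left; apply/orP; left; apply/imfsetP; exists a => //=.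
    by rewrite mem_zrange; lia.
  apply/orP; right; case: (i \in I) wa => /= wa; first by lia.
  by rewrite inE; apply/eqP; congr Rtri; lia.
have -> : Ltri a c = Ltri a ((c + a + 1) - a - 1) by congr Ltri; lia.
rewrite LB; move: (c + a + 1) => {}c /and5P[a1 a2 c1 c2 wa].
rewrite !in_fsetU; have [kc|ck] := leP k%:Z c.
  apply/orP; left; apply/orP; right; apply/imfset2P; exists c.
    by rewrite /= mem_zrange; rewrite /H in c2; lia.
  by exists a; rewrite //= mem_zrange /lam1 -/n0; lia.
apply/orP; right; have ck' : (absz c < k)%N by lia.
have [i [li pi Si]] := row_index ck'; have lcn := row_part_le ck'.
have cE : (absz c)%:Z = c by lia.
apply/bigfcupP; exists i; first by rewrite mem_enum.
rewrite !in_fsetU li pi cE; move: wa; rewrite /ws ck' => wa.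
apply/orP; left; apply/orP; right; apply/imfsetP; exists a => //=.
by rewrite mem_zrange; lia.
Qed.

Local Notation A := (regionA m lam I).
Local Notation B := (half_B pred0).
Local Notation w := (weightAtilde lam I).

Lemma bs_le c : (c < H)%N -> (bs c <= n0)%N.
Proof. by move=> cH; apply: leq_trans (leq_subr _ _) (ws_le cH). Qed.

Lemma mem_cross_L X a (c : int) : 0 <= c ->
  has (fun d => Ltri a c \in cross d) X = (a == -1) && (absz c \in X).
Proof.
move=> c0; apply/hasP/andP => [[d dX]|[/eqP -> cX]].
  by rewrite !inE => /orP[]/eqP // [-> ->].
by exists (absz c); rewrite // /cross gez0_abs // !inE eqxx.
Qed.

Lemma mem_cross_R X a (c : int) : 0 <= c ->
  has (fun d => Rtri a c \in cross d) X = (a == 0) && (absz c \in X).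
Proof.
move=> c0; apply/hasP/andP => [[d dX]|[/eqP -> cX]].
  by rewrite !inE => /orP[]/eqP // [-> ->].
by exists (absz c); rewrite // /cross gez0_abs // !inE eqxx orbT.
Qed.

Lemma regionA_left : left_half A.
Proof.
rewrite regionA_half => -[] a c; first by rewrite (in_half_A pred0 false) => /and5P[].
by rewrite (in_half_A pred0 true) => /and5P[].
Qed.

Lemma half_A_strip X : half_A (mem X) = strip A X.
Proof.
rewrite regionA_half; apply/fsetP => -[] a c; rewrite in_strip.
  rewrite !(in_half_A _ false).
  apply/idP/andP => [/and5P[a1 a2 c1 c2 P]|[]].
    by rewrite a1 a2 c1 c2 mem_cross_R //; split=> //; rewrite negb_and; lia.
  by [].
rewrite !(in_half_A _ true) /partial /=.
have [c0|c0] := leP 0 c; last by rewrite !andbF.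
rewrite mem_cross_L //; case: (absz c \in X) => /=; apply/idP/idP; lia.
Qed.

Lemma half_B_right t : t \in B -> match t with Rtri a _ | Ltri a _ => 0 <= a end.
Proof.
case: t => a c.
  have -> : Rtri a c = Rtri a ((c + a) - a) by rewrite addrK.
  by rewrite (in_half_B pred0 true) => /and5P[].
have -> : Ltri a c = Ltri a ((c + a + 1) - a - 1) by congr Ltri; lia.
by rewrite (in_half_B pred0 false) => /and5P[].
Qed.

Lemma half_B_strip X : half_B (mem X) = strip B X.
Proof.
apply/fsetP => -[] a c; rewrite in_strip.
  have -> : Rtri a c = Rtri a ((c + a) - a) by rewrite addrK.
  move: (c + a) => {}c; rewrite !(in_half_B _ true) /partial /=.
  have [c0|c0] := leP 0 c; last by rewrite !andbF.
  have [a0|a0] := eqVneq a 0.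
    rewrite a0 !subr0 mem_cross_R //; case: (absz c \in X) => /=; apply/idP/idP; lia.
  have -> : has (fun d => Rtri a (c - a) \in cross d) X = false.
    apply/negP => /hasP[d _]; rewrite !inE => /orP[]/eqP // [aE _].
    by rewrite aE eqxx in a0.
  by case: (absz c \in X) => /=; apply/idP/idP; lia.
have -> : Ltri a c = Ltri a ((c + a + 1) - a - 1) by congr Ltri; lia.
move: (c + a + 1) => {}c; rewrite !(in_half_B _ false) /partial /=.
have [a0|a0] := leP 0 a; last by [].
have -> : has (fun d => Ltri a (c - a - 1) \in cross d) X = false.
  apply/negP => /hasP[d _]; rewrite !inE => /orP[]/eqP // [aE _].
  by rewrite aE in a0.
by rewrite [RHS]andbT.
Qed.

Lemma axis_in_A (c : nat) : (c < H)%N -> (Ltri (-1) c%:Z \in A) = (bs c < n0)%N.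
Proof.
move=> cH; rewrite regionA_half (in_half_A _ true) /partial /= .
by apply/idP/idP; lia.
Qed.

Lemma axis_in_B (c : nat) : (c < H)%N -> Rtri 0 c%:Z \in B.
Proof.
move=> cH; have := bs_le cH; rewrite -[c%:Z in X in _ -> X]subr0 (in_half_B _ true) /partial /=.
by lia.
Qed.

Lemma axis_bounded c : Ltri (-1) c \in A -> exists2 c' : nat, (c' < H)%N & c = c'%:Z.
Proof.
rewrite regionA_half (in_half_A _ true) => /and5P[_ _ c0 cH _].
by exists (absz c); lia.
Qed.

Lemma weight_lozenge j c j' c' :
  (forall i : 'I_k, i \notin I ->
     embB (false, (j, c)) = Ltri (part lam i - 1) (level i - part lam i) ->
     embB (true, (j', c')) = Rtri (part lam i) (level i - part lam i) -> False) ->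
  w [fset embB (false, (j, c)); embB (true, (j', c'))] = 1.
Proof.
move=> ne; rewrite /weightAtilde ifF //; apply/existsP => -[i /andP[iI /eqP/fsetP E]].
have := E (Rtri (part lam i) (level i - part lam i)).
have := E (Ltri (part lam i - 1) (level i - part lam i)).
rewrite !in_fset2 !eqxx orbT orTb => /orP[/eqP EL|/eqP //] /orP[/eqP //|/eqP ER].
by apply: ne iI _ _.
Qed.

Lemma countS0 : count S0 (iota 0 H) = (k - #|I|)%N.
Proof.
rewrite /height addnC iotaD count_cat add0n.
have -> : count S0 (iota k m) = 0%N.
  apply/eqP; rewrite -leqn0 leqNgt -has_count; apply/hasPn => c.
  by rewrite mem_iota => /andP[kc _]; apply/negP => /active_lt; lia.
rewrite addn0 -sum1_count -[k in iota 0 k]subn0 -/(index_iota 0 k) big_mkord.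
rewrite (reindex_inj rev_ord_inj) /=.
have -> : (k - #|I| = #|~: I|)%N by rewrite [RHS]cardsCs setCK card_ord.
rewrite -sum1_card.
apply: eq_bigl => i; have [c [ck lc _ Sc]] := index_row i.
rewrite inE -Sc; congr (S0 _); have := ltn_ord i; move: lc; rewrite /level; lia.
Qed.

(** A lozenge of weight 1/2 joins the end triangle, black in column [bs c], to the first white
    triangle of its row, in column [ws c]. *)
Lemma w_left_B j c : (j.+1 < n0.+1)%N -> (c < H)%N -> (ws c <= j.+1)%N -> (bs c <= j)%N ->
  w [fset embB (false, (j.+1, c)); embB (true, (j, c))] =
    (if S0 c && (j.+1 == ws c) then 1 / 2 else 1).
Proof.
move=> jn cH wj bj; case: ifP => [/andP[Sc /eqP jw]|nSw].
  rewrite /weightAtilde ifT //; have ck := active_lt Sc.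
  have [i [li pi Si]] := row_index ck; apply/existsP; exists i; rewrite -Si Sc /= li pi.
  apply/eqP; have := row_part_le ck; move: jw; rewrite /ws ck => jw lc.
  by congr [fset _; _]; [congr Ltri | congr Rtri]; lia.
apply: weight_lozenge => i iI _ /= [ea ec].
have [c' [ck lc pc Sc]] := index_row i; rewrite lc pc in ea ec.
have cc : c = c' by lia.
move: nSw; rewrite cc Sc iI /= /ws ck; have := row_part_le ck; lia.
Qed.

(** Lozenges of weight 1/2 join two different columns, unlike this one. *)
Lemma w_up_B j c : (j < n0.+1)%N -> (c < H)%N -> (ws c <= j)%N ->
  w [fset embB (false, (j, c)); embB (true, (j, c))] = 1.
Proof. by move=> jn cH wj; apply: weight_lozenge => i iI /= [ea ec] [ea' ec']; lia. Qed.

Lemma w_hop_B j c : (j < n0.+1)%N -> (c.+1 < H)%N -> (ws c.+1 <= j)%N -> (bs c <= j)%N ->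
  w [fset embB (false, (j, c.+1)); embB (true, (j, c))] = 1.
Proof. by move=> jn cH wj bj; apply: weight_lozenge => i iI /= [ea ec] [ea' ec']; lia. Qed.

Definition ZA := count_half embA (fun=> 1) n0 H ws S0 1.
(** The scale 2 per height in [S0] accounts for the power of 2 in the theorem. *)
Definition ZB := count_half embB w n0.+1 H ws S0 2.

Lemma represents_A : represents H S0 ZA (fun d c => shifted ws S0 acoef d n0 c).
Proof.
have F0 r : acoef 0 r = 1 *+ (r == 0%N) by case: r => [|r]; rewrite ?acoefr0 ?acoef0.
apply: (@represents_half _ _ _ _ embA_inj embA_adj _ _ 1 1 ws_gt0 ws_le _ _ _ (shifted ws S0 acoef)).
- by [].
- by [].
- by move=> j c *; case: ifP.
- by move=> d c _ _ _; apply: shifted0.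
- move=> d j c dH Sd cH _; exact: (@shifted_wait H _ _ ws_mono acoef 1).
- move=> d j c dH Sd cH _.
  by apply: (@shifted_step H _ _ ws_gt0 ws_mono acoef 1) => // *; rewrite ?acoefr0 ?mulr1 // acoefS.
- by move=> c c' _ _ _; apply: (@shifted_absent _ _ acoef 1).
Qed.

Lemma represents_B : represents H S0 ZB (fun d c => shifted ws S0 bcoef d n0.+1 c).
Proof.
apply: (@represents_half _ _ _ _ embB_inj embB_adj _ _ (1 / 2) 2 ws_gt0 _ _ _ _ (shifted ws S0 bcoef)).
- by move=> c /ws_le; apply: leqW.
- exact: w_up_B.
- exact: w_hop_B.
- exact: w_left_B.
- by move=> d c _ _ _; apply: shifted0.
- move=> d j c dH Sd cH _; exact: (@shifted_wait H _ _ ws_mono bcoef 2).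
- move=> d j c dH Sd cH _.
  by apply: (@shifted_step H _ _ ws_gt0 ws_mono bcoef 2) => // *; rewrite ?bcoefr0 ?bcoefS.
- by move=> c c' _ _ _; apply: (@shifted_absent _ _ bcoef 2).
Qed.

Lemma Mf_regionA : (Mf A)%:R = \sum_(X <- subseqs H) ZA X.
Proof.
rewrite (Mf_sum regionA_left axis_bounded) big_seq [RHS]big_seq; apply: eq_bigr => X XS.
rewrite (M_axis_right regionA_left (uniq_subseqs XS)) /ZA /count_half expr1n mul1r -half_A_strip.
congr (if _ then _ else _); apply: eq_in_all => c cX.
by rewrite axis_in_A // (subseqs_lt XS cX).
Qed.

Lemma M_regionAtilde :
  2 ^+ (k - #|I|) * M w (regionAtilde m lam I) = \sum_(X <- subseqs H) ZA X * ZB X.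
Proof.
rewrite regionAtilde_half (@M_cross _ _ H) => [|c cH]; last first.
  (* Axis lozenges have weight 1: a lozenge of weight 1/2 has its R triangle in column [part lam i],
     which is positive. *)
  rewrite /weightAtilde ifF //; apply/existsP => -[i /andP[_ /eqP/fsetP/(_ (Rtri 0 c%:Z))]].
  rewrite !in_fset2 eqxx orbT => /esym/orP[/eqP //|/eqP[pE _]].
  have [c' [ck _ [pc] _]] := index_row i.
  by have := row_part_gt0 ck; rewrite -pc -pE.
rewrite mulr_sumr big_seq [RHS]big_seq; apply: eq_bigr => X XS.
have Xlt c : c \in X -> (c < H)%N by apply: subseqs_lt.
rewrite /ZA /ZB /count_half expr1n mul1r countS0.
have -> : all (fun c => bs c < n0.+1)%N X by apply/allP => c /Xlt cH; rewrite ltnS bs_le.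
have -> : all (fun c => cross c `<=` A `|` B) X = all (fun c => bs c < n0)%N X.
  apply: eq_in_all => c /Xlt cH; rewrite -axis_in_A //; apply/fsubsetP/idP => [AB|cA t].
    have : Ltri (-1) c%:Z \in A `|` B by apply: AB; rewrite !inE eqxx.
    by rewrite in_fsetU => /orP[//|/half_B_right].
  by rewrite in_fset2 in_fsetU => /orP[]/eqP ->; rewrite ?cA ?axis_in_B ?orbT.
case: ifP => Xall; last by rewrite mulr0 mul0r.
have -> : strip (A `|` B) X = strip A X `|` strip B X.
  by apply/fsetP => t; rewrite in_fsetU !in_strip in_fsetU andb_orl.
have sA t : t \in strip A X -> t \in A by rewrite in_strip => /andP[].
have sB t : t \in strip B X -> t \in B by rewrite in_strip => /andP[].
rewrite M_disjoint.
- rewrite mulrCA; congr (_ * (_ * _)).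
  + rewrite -/(half_A (mem X)) half_A_strip; apply: M_eq => l lz /fsubsetP lS; rewrite /cut ifF.
      rewrite /weightAtilde ifF //; apply/existsP => -[i /andP[_ /eqP lE]].
      have /sA/regionA_left : Rtri (part lam i) (level i - part lam i) \in strip A X.
        by apply: lS; rewrite lE in_fset2 eqxx orbT.
      by rewrite /part; lia.
    apply/hasP => -[c _ /eqP lE].
    have /sA/regionA_left // : Rtri 0 c%:Z \in strip A X.
    by apply: lS; rewrite lE in_fset2 eqxx orbT.
  + rewrite -/(half_B (mem X)) half_B_strip; apply: M_eq => l lz /fsubsetP lS; rewrite /cut ifF //.
    apply/hasP => -[c _ /eqP lE].
    have /sB/half_B_right // : Ltri (-1) c%:Z \in strip B X.
    by apply: lS; rewrite lE in_fset2 eqxx.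
- move=> t u /sA tA /sB uB; have := regionA_left tA; have := half_B_right uB.
  case: t tA => a c tA; case: u uB => a' c' uB; rewrite ?share_edge_RR ?share_edge_LL //.
    by rewrite share_edge_RL; lia.
  rewrite share_edgeC share_edge_RL => a0 a1 ac.
  (* The only lozenges joining the two halves are the [cross d], annulled by [cut]. *)
  have [ea ea' ec] : [/\ a = -1, a' = 0 & c' = c] by split; lia.
  subst a a' c'; have [d dH dE] := axis_bounded tA.
  by rewrite /cut ifT //; apply/hasP; exists d; rewrite ?mem_iota // dE.
- apply/fdisjointP => t /sA/regionA_left tA; apply/negP => /sB/half_B_right.
  by case: t tA => a c; lia.
Qed.

End Geometry.

Theorem theorem3p1 (m k : nat) (lam : k.-tuple nat) (I : {set 'I_k})
    (hlam : strict_partition lam) :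
  (Mf (regionA m lam I))%:R ^+ 2 =
    2 ^+ (k - #|I|) * M (weightAtilde lam I) (regionAtilde m lam I) :> rat.
Proof.
rewrite (M_regionAtilde m I hlam) (Mf_regionA m I hlam).
apply: (sqr_sum_represents (@represents_A m k lam I hlam) (@represents_B m k lam I hlam)).
move=> d c dH cH Sd.
exact: (@shifted_cumul _ _ _ _ (@ws_gt0 m k lam I hlam) (@ws_le m k lam hlam) d c dH cH Sd).
Qed.
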